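(* Let $f \in \mathbb{Z}[X_1, X_2]$ be a polynomial irreducible over $\mathbb{Q}$, of degree $d_1$ in $X_1$ and degree $d_2 \ge 1$ in $X_2$. Then for all $B_1 \ge 1$ and $B_2 \ge 2$, \[ N_{\mathrm{rat}}(f, B_1, B_2) \ll_{d_1, d_2} B_1^{2/d_2} (\log B_2)^2 . \]
   Context: The height of a rational number $t = x/y$ in lowest terms is $H(t) = \max(|x|,|y|)$. $N_{\mathrm{rat}}(f,B_1,B_2)$ is the number of $(x_1,x_2)\in\mathbb{Q}^2$ with $f(x_1,x_2)=0$, $H(x_1)\le B_1$ and $H(x_2)\le B_2$. $U \ll_\rho V$ means $|U|\le cV$ for a positive constant $c$ depending only on $\rho$. *)

(* Defs.v *)
From HB Require Import structures.
From mathcomp Require Import all_boot all_order all_algebra.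
From mathcomp Require Import all_classical all_reals all_analysis.
Set Implicit Arguments. Unset Strict Implicit. Unset Printing Implicit Defensive.
Import Order.TTheory GRing.Theory Num.Theory.
Local Open Scope ring_scope.

(* A bivariate integer polynomial f(X1,X2) is represented as an element of
   {poly {poly int}}: the OUTER variable is X2, the INNER variable is X1,
   i.e. f = \sum_j f_j(X1) X2^j with f_j = f`_j in {poly int}. *)

Definition degX2 (f : {poly {poly int}}) : nat := (size f).-1.
Definition degX1 (f : {poly {poly int}}) : nat :=
  (\max_(i < size f) (size (nth 0%R f i)).-1)%N.

Definition irreducible_elt (R : idomainType) (p : R) : Prop :=
  p != 0 /\ p \isn't a GRing.unit /\
  forall a b : R, p = a * b -> a \is a GRing.unit \/ b \is a GRing.unit.

Definition toQ (f : {poly {poly int}}) : {poly {poly rat}} :=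
  map_poly (map_poly (intr : int -> rat)) f.

Definition irreducible_over_Q (f : {poly {poly int}}) : Prop :=
  irreducible_elt (toQ f).

Definition eval2 (f : {poly {poly int}}) (x1 x2 : rat) : rat :=
  (map_poly (fun c : {poly int} => (map_poly (intr : int -> rat) c).[x1]) f).[x2].

Definition ht (t : rat) : nat := maxn `|numq t|%N `|denq t|%N.

Definition ht_seq (N : nat) : seq rat :=
  undup [seq ((a%:~R : rat) / (b%:R : rat)) |
           a <- [seq (i%:Z - N%:Z) | i <- iota 0 (2 * N).+1], b <- iota 1 N].

Definition N_rat (R : realType) (f : {poly {poly int}}) (B1 B2 : R) : nat :=
  size [seq p <- [seq (x, y) | x <- ht_seq (Num.truncn B1), y <- ht_seq (Num.truncn B2)]
       | [&& eval2 f p.1 p.2 == 0, ((ht p.1)%:R <= B1) & ((ht p.2)%:R <= B2)]].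

(* Main.v *)
Require Import Defs.
From mathcomp Require Import all_boot all_order all_algebra all_field.
From mathcomp Require Import all_classical all_reals all_analysis.
From mathcomp Require Import perm zify ring lra.
Set Implicit Arguments. Unset Strict Implicit. Unset Printing Implicit Defensive.
Import Order.TTheory GRing.Theory Num.Theory.
Local Open Scope ring_scope.

(* A p-adic determinant argument, with the determinant replaced by the pigeonhole
   principle. Write L for log B2 and take a prime p somewhat larger than B1^(2/d2).
   In the residue class mod p of a point where p divides neither the denominators
   nor df/dX2, X2 is mod p^K a polynomial in X1, so the vanishing mod p^K of a
   polynomial G on the class amounts to few linear congruences on its coefficients.
   Pigeonhole solves them with deg_X1 G < 2L, deg_X2 G < d2 and coefficients so
   small that G vanishes exactly on the class; as f is irreducible and does not
   divide G, Bezout leaves O(L) points. There are O(p) classes. After replacing f by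
   a polynomial with coefficients of size B2^O(1) through the same points, the
   integer that p must not divide has size B2^O(1); averaging over the primes in a
   window of length O(B1^(2/d2) L) gives one that is good for half of the points. *)

(** * Resultants and a weak Bezout bound over the rationals *)

(* Gauss's lemma: a root [a] of [c] kills q or r mod its minimal polynomial, which can
   then be divided out of both sides. *)
Lemma gauss_cancel (f q r : {poly {poly rat}}) (c : {poly rat}) :
  c != 0 -> c *: f = q * r ->
  exists q' r' : {poly {poly rat}},
    [/\ f = q' * r', size q' = size q & size r' = size r].
Proof.
have [n] := ubnP (size c); elim: n c q r => // n IHn c q r ltn c0 E.
have [s1|sn1] := eqVneq (size c) 1%N.
  have cU : c \is a GRing.unit.
    by have /size_poly1P[k k0 ->] := introT eqP s1; rewrite poly_unitE size_polyC k0 coefC eqxx unitfE.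
  exists (c^-1 *: q), r; split => //.
    by rewrite -scalerAl -E scalerA mulVr // scale1r.
  by rewrite size_scale // invr_eq0.
have [a ra] : exists a, root (map_poly ratr c : {poly algC}) a.
  by apply/closed_rootP; rewrite size_map_poly.
have [pi [_ _ piP]] := minCpolyP a.
have pic : pi %| c by rewrite -piP.
have [ev evP] : exists ev : {rmorphism {poly rat} -> algC}, forall p, (ev p == 0) = (pi %| p).
  by exists (horner_eval a \o map_poly ratr) => p; rewrite -piP.
have sizepi : (size pi > 1)%N.
  have p0 : pi != 0 by apply: contraNneq c0 => p0; move: pic; rewrite p0 dvd0p.
  have := evP 1; rewrite rmorph1 oner_eq0 dvdp1 => /esym; move: p0; rewrite -size_poly_gt0.
  by case: (size pi) => [|[|]].
have [c' Ec] : exists c' : {poly rat}, c = c' * pi by apply/dvdpP.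
have pi0 : pi != 0 by rewrite -size_poly_gt0 ltnW.
have c'0 : c' != 0 by apply: contraNneq c0; rewrite Ec => ->; rewrite mul0r.
have szc' : (size c' < n)%N.
  move: ltn sizepi; rewrite Ec size_mul //; case: (size pi) => [|[|k]] //; by rewrite !addnS => h _; exact: leq_ltn_trans (leq_addr k _) h.
have divP (p : {poly {poly rat}}) : map_poly ev p = 0 -> exists p', p = pi *: p'.
  move=> p0; exists (\poly_(i < size p) (p`_i %/ pi)).
  apply/polyP => i; rewrite coefZ coef_poly; case: ltnP => [_|h]; last by rewrite nth_default // mulr0.
  have : ev p`_i == 0 by rewrite -coef_map p0 coef0.
  by rewrite evP => /divpK; rewrite mulrC => ->.
have : map_poly ev q * map_poly ev r = 0.
  rewrite -rmorphM -E; apply/polyP => i; rewrite coef_map coefZ coef0; apply: etrans (rmorphM ev _ _) _.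
  have /eqP -> : ev c == 0 by rewrite evP.
  by rewrite mul0r.
have piI : injective (fun p : {poly {poly rat}} => pi *: p).
  by move=> x y /=; rewrite -!mul_polyC; apply: mulfI; rewrite polyC_eq0.
move/eqP; rewrite mulf_eq0 => /orP[] /eqP /divP[p' Ep].
  have E' : c' *: f = p' * r.
    by apply: piI; rewrite /= scalerA mulrC -Ec E Ep scalerAl.
  have [q1 [r1 [-> Hq Hr]]] := IHn _ _ _ szc' c'0 E'.
  by exists q1, r1; split=> //; rewrite Ep size_scale.
have E' : c' *: f = q * p'.
  by apply: piI; rewrite /= scalerA mulrC -Ec E Ep scalerAr.
have [q1 [r1 [-> Hq Hr]]] := IHn _ _ _ szc' c'0 E'.
by exists q1, r1; split=> //; rewrite Ep size_scale.
Qed.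

(** A zero resultant means a common factor of positive degree in X2. Divisibility in
    [{poly {poly rat}}] only factors a multiple [c *: f]; [gauss_cancel] removes [c] and leaves a
    proper factorization of [f]. *)
Lemma irreducible_resultant_neq0 (f g : {poly {poly rat}}) :
  irreducible_elt f -> g != 0 -> (size g < size f)%N -> resultant f g != 0.
Proof.
move=> [f0 [_ firr]] g0 sgf; rewrite resultant_eq0 -leqNgt leqNgt.
apply/negP => gt1; set r := gcdp f g in gt1.
have /Pdiv.Idomain.dvdpP[[c q] /= c0 E] : Pdiv.Idomain.dvdp r f by exact: dvdp_gcdl.
have srg : (size r <= size g)%N by apply: Pdiv.Idomain.dvdp_leq => //; exact: dvdp_gcdr.
have [q1 [r1 [Ef sq sr]]] := gauss_cancel c0 E.
have := firr _ _ Ef; rewrite !poly_unitE sr.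
have q10 : q1 != 0 by apply: contraNneq f0; rewrite Ef => ->; rewrite mul0r.
have r10 : r1 != 0 by rewrite -size_poly_gt0 sr ltnW.
move: sgf; rewrite Ef size_mul // sr => sgf.
case=> /andP[/eqP h _]; last by rewrite h in gt1.
by move: sgf; rewrite h add1n /= ltnNge srg.
Qed.

Lemma size_det_leq (n m : nat) (A : 'M[{poly rat}]_n) :
  (forall i j, (size (A i j) <= m.+1)%N) -> (size (\det A) <= (n * m).+1)%N.
Proof.
move=> hA; apply: (leq_trans (size_sum _ _ _)); apply/bigmax_leqP => s _.
rewrite size_Msign ; apply: (leq_trans (size_poly_prod_leq _ _)).
have aux S : (S <= n * m.+1 -> S.+1 - n <= (n * m).+1)%N by rewrite mulnS; lia.
rewrite card_ord; apply: aux.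
by rewrite -[X in (_ <= X * _)%N](card_ord n) -sum_nat_const; apply: leq_sum => i _.
Qed.

(** The Sylvester matrix has at most [2 * d] rows, and its entries are zero or coefficients of [f]
    and [g]. *)
Lemma size_resultant_leq (f g : {poly {poly rat}}) (d m : nat) :
  (size f <= d.+1)%N -> (size g <= d.+1)%N ->
  (forall j, (size (f`_j)%R <= m.+1)%N) -> (forall j, (size (g`_j)%R <= m.+1)%N) ->
  (size (resultant f g) <= (2 * d * m).+1)%N.
Proof.
move=> sf sg hf hg; apply: leq_trans (size_det_leq (m := m) _) _ => [i j|].
  by rewrite Sylvester_mxE /=; case: fintype.split => k; case: (k <= j)%N; rewrite /= ?mulr1n ?mulr0n ?size_poly0.
by rewrite ltnS leq_mul2r; apply/orP; right; move: sf sg; case: (size f) => [|a]; case: (size g) => [|b] /=; lia.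
Qed.

(* As in [Defs], the outer variable is X2 and is evaluated at [y]. *)
Definition ev2 (R : nzRingType) (f : {poly {poly R}}) (x y : R) : R := f.[y%:P].[x].

(** Fibre counting, used for the coordinate projections and for reduction mod p. *)
Lemma size_fiber_leq (T U : eqType) (phi : T -> U) (s : seq T) (B : nat) :
  (forall u, size [seq x <- s | phi x == u] <= B)%N ->
  (size s <= size (undup (map phi s)) * B)%N.
Proof.
move=> hB; have -> : size s = (\sum_(u <- undup (map phi s)) count (fun x => phi x == u) s)%N.
  rewrite -sum1_size (eq_bigr (fun u => \sum_(x <- s | phi x == u) 1))%N; last first.
    by move=> u _; rewrite sum1_count.
  rewrite (exchange_big_dep xpredT) //= !big_seq; apply: eq_bigr => x xs.
  have xin : phi x \in undup (map phi s) by rewrite mem_undup map_f.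
  by rewrite -big_filter (bigD1_seq (phi x)) ?filter_uniq ?undup_uniq ?mem_filter ?eqxx //=
    -big_filter -filter_predI (@eq_filter _ _ pred0) ?filter_pred0 ?big_nil // => u /=; rewrite eq_sym; case: eqP.
rewrite -[X in (_ <= X * _)%N]sum1_size big_distrl /=; apply: leq_sum => u _.
by rewrite mul1n -size_filter.
Qed.

Lemma uniq_fst_fiber (T U : eqType) (s : seq (T * U)) u :
  uniq s -> uniq (map snd [seq x <- s | x.1 == u]).
Proof.
move=> us; rewrite map_inj_in_uniq ?filter_uniq // => -[a b] [a' b'].
by rewrite !mem_filter /= => /andP[/eqP -> _] /andP[/eqP -> _] ->.
Qed.

Lemma ev2_spec (R : comNzRingType) (f : {poly {poly R}}) x y :
  ev2 f x y = (map_poly (horner_eval x) f).[y].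
Proof.
rewrite /ev2 -[LHS]/(horner_eval x f.[y%:P]) -horner_map.
by congr (_.[_]); rewrite /= /horner_eval hornerC.
Qed.

(** If [f] is not zero on the vertical line X1 = [x], its degree bounds the number of roots;
    otherwise ['X - x%:P] divides every coefficient, a nontrivial factor since [f] has positive
    degree in X2. *)
Lemma irreducible_fiber_leq (f : {poly {poly rat}}) (x : rat) (s : seq rat) :
  irreducible_elt f -> (1 < size f)%N -> uniq s ->
  (forall y, y \in s -> ev2 f x y = 0) -> (size s <= (size f).-1)%N.
Proof.
move=> [f0 [_ firr]] sf us hs; set q := map_poly (horner_eval x) f.
have [q0|qn0] := eqVneq q 0; last first.
  have := max_poly_roots qn0 (rs := s).
  have -> : all (root q) s by apply/allP => y /hs; rewrite ev2_spec => h; apply/rootP.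
  move=> /(_ isT us) h; rewrite -ltnS prednK ?(ltnW sf) //.
  by apply: leq_trans h _; rewrite /q map_polyE; apply: leq_trans (size_Poly _) _; rewrite size_map.
exfalso; pose f' := \poly_(i < size f) (f`_i %/ ('X - x%:P)).
have Ef : f = ('X - x%:P)%:P * f'.
  apply/polyP => i; rewrite coefCM coef_poly; case: ltnP => h; last by rewrite nth_default // mulr0.
  have : root f`_i x by apply/rootP; have := coef_map (horner_eval x) f i; rewrite -/q q0 coef0 => ->.
  by rewrite root_factor_theorem => /divpK; rewrite mulrC => ->.
have Xn0 : 'X - x%:P != 0 :> {poly rat} by rewrite polyXsubC_eq0.
have := firr _ _ Ef; rewrite !poly_unitE => -[] /andP[].
  by rewrite coefC /= size_XsubC.
by move=> /eqP s1; move: sf; rewrite Ef mul_polyC size_scale // s1.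
Qed.

(** A nonzero element of the ideal of [f] and [g] that is free of X2 vanishes at the first
    coordinate of every common zero, and each vertical line carries at most [(size f).-1] zeros of
    [f]. *)
Lemma bezout_bound (f g : {poly {poly rat}}) (m : nat) (s : seq (rat * rat)) :
  irreducible_elt f -> g != 0 -> (size g < size f)%N ->
  (forall j, size (f`_j)%R <= m.+1)%N -> (forall j, size (g`_j)%R <= m.+1)%N ->
  uniq s -> (forall z, z \in s -> ev2 f z.1 z.2 = 0 /\ ev2 g z.1 z.2 = 0) ->
  (size s <= 2 * (size f).-1 * m * (size f).-1)%N.
Proof.
move=> firr g0 sgf hf hg us hs.
have sf1 : (1 < size f)%N by move: sgf; rewrite -size_poly_gt0 in g0; lia.
apply: leq_trans (size_fiber_leq (phi := fst) (B := (size f).-1) _) _ => [u|].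
  rewrite -(size_map snd); apply: (@irreducible_fiber_leq _ u) firr sf1 (uniq_fst_fiber _ us) _.
  move=> y /mapP[[a b]]; rewrite mem_filter => /andP[/= /eqP -> /hs[]] /=.
  by move=> h _ ->.
rewrite leq_mul2r; apply/orP; right.
have [p p0 [sp [U [V E]]]] : exists2 p : {poly rat}, p != 0 &
    (size p <= (2 * (size f).-1 * m).+1)%N /\ exists U V, p%:P = U * f + V * g.
  (* [resultant_in_ideal] asks for positive degree in X2; a [g] of degree 0 in X2 is itself the
     eliminant. *)
  have [sg1|sg1] := leqP (size g) 1.
    exists g`_0; first by rewrite -polyC_eq0 -(size1_polyC sg1).
    split; last by exists 0, 1; rewrite mul0r add0r mul1r -(size1_polyC sg1).
    by apply: leq_trans (hg 0%N) _; rewrite ltnS leq_pmull // muln_gt0 /= -subn1 subn_gt0.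
  exists (resultant f g); first exact: irreducible_resultant_neq0.
  split; last first.
    by have [[U V] /= _ E] := resultant_in_ideal sf1 sg1; exists U, V.
  by apply: size_resultant_leq => //; rewrite prednK ?(ltnW sf1) // ltnW.
suff h : (size (undup (map fst s)) < size p)%N by rewrite -ltnS; apply: leq_trans h sp.
apply: max_poly_roots => //; last exact: undup_uniq.
apply/allP => x; rewrite mem_undup => /mapP[[a b] /hs[/= h1 h2] ->] /=.
apply/rootP; have := congr1 (fun h => ev2 h a b) E.
by rewrite /ev2 hornerC hornerD !hornerM hornerD !hornerM -!/(ev2 _ a b) h1 h2 !mulr0 addr0.
Qed.

(** * Siegel's lemma, modular and exact, by pigeonhole *)

Lemma intr_sum (R : nzRingType) (J : finType) (F : J -> int) :
  (\sum_j F j)%:~R = \sum_j (F j)%:~R :> R.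
Proof. exact: (rmorph_sum (intmul 1)). Qed.

(** Vectors with entries in ['I_H] outnumber the possible residue vectors, so two of them collide,
    and their difference solves the congruences. *)
Lemma siegel_mod (I J : finType) (q : I -> nat) (A : I -> J -> int) (H : nat) :
  (forall i, 0 < q i)%N -> (\prod_i q i < H ^ #|J|)%N ->
  exists v : J -> int, [/\ exists j, v j != 0, forall j, `|v j| < H%:Z
    & forall i, ((q i)%:Z %| \sum_j A i j * v j)%Z].
Proof.
move=> q0 qH; pose S i (u : {ffun J -> 'I_H}) : int := \sum_j A i j * (u j : nat)%:Z.
have ltS i u : (`|(S i u %% (q i)%:Z)%Z| < q i)%N.
  have qz : 0 < (q i)%:Z by rewrite ltz_nat.
  by rewrite -ltz_nat gez0_abs ?modz_ge0 ?gt_eqF // ltz_pmod.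
pose phi u : {dffun forall i, 'I_(q i)} := [ffun i => Ordinal (ltS i u)].
have /injectivePn[u [w uw E]] : ~~ injectiveb phi.
  apply: contraL qH => /injectiveP /leq_card; rewrite card_ffun card_ord card_dep_ffun -leqNgt.
  by rewrite foldrE big_map big_enum; under eq_bigr do rewrite card_ord.
exists (fun j => (u j : nat)%:Z - (w j : nat)%:Z); split.
- have /existsP[j jP] : [exists j, u j != w j].
    apply: contraR uw; rewrite negb_exists => /forallP h.
    by apply/eqP/ffunP => j; apply/eqP; have := h j; rewrite negbK.
  by exists j; rewrite subr_eq0 eqz_nat.
- by move=> j; have := ltn_ord (u j); have := ltn_ord (w j); lia.
- move=> i; have -> : \sum_j A i j * ((u j : nat)%:Z - (w j : nat)%:Z) = S i u - S i w.
    by rewrite /S -sumrB; apply: eq_bigr => j _; rewrite mulrBr.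
  rewrite -eqz_mod_dvd; have qz : (q i)%:Z != 0 by rewrite eqz_nat -lt0n.
  have := congr1 (fun f : {dffun forall i, 'I_(q i)} => nat_of_ord (f i)) E.
  rewrite /phi !ffunE /= => E'; apply/eqP.
  by rewrite -[LHS]gez0_abs ?modz_ge0 // -[RHS]gez0_abs ?modz_ge0 // E'.
Qed.

(** The bound is independent of the number [n] of equations: a maximal independent set of rows
    implies the others, and it has fewer than [#|J|] rows because of the kernel vector [w]. For
    these rows, a modulus larger than every possible value of the sums turns congruences into
    equations. *)
Lemma siegel_small (J : finType) (n : nat) (a : 'I_n -> J -> int) (E : nat)
    (w : J -> rat) (j0 : J) :
  (0 < E)%N -> (forall i j, `|a i j| <= E%:Z) -> w j0 != 0 ->
  (forall i, \sum_j (a i j)%:~R * w j = 0) ->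
  exists v : J -> int, [/\ exists j, v j != 0,
    forall j, `|v j| < ((#|J| * E) ^ #|J|).+1%:Z & forall i, \sum_j a i j * v j = 0].
Proof.
move=> E0 aE w0 aw; set m := #|J|; set H := ((m * E) ^ m).+1.
pose B : 'M[rat]_(n, m) := \matrix_(i, k) (a i (enum_val k))%:~R.
pose W : 'cV[rat]_m := \col_k w (enum_val k).
have sumJ (R : nmodType) (F : J -> R) : \sum_j F j = \sum_(k < m) F (enum_val k).
  by rewrite (reindex (@enum_val J predT)) //; apply: onW_bij; exact: enum_val_bij.
have BW : B *m W = 0.
  apply/colP => i; rewrite !mxE -[RHS](aw i) sumJ.
  by apply: eq_bigr => k _; rewrite !mxE.
have m0 : (0 < m)%N by apply/card_gt0P; exists j0.
have rB : (\rank B < m)%N.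
  rewrite ltn_neqAle rank_leq_col andbT; apply: contra w0 => rf.
  have /row_fullP[D DB] : row_full B by [].
  have : W = 0 by rewrite -[W]mul1mx -DB -mulmxA BW mulmx0.
  by move/colP/(_ (enum_rank j0)); rewrite !mxE enum_rankK => ->.
pose f := maxrankfun B.
(* With r the rank, [(m * E) ^ r < H] by the choice of [H], and [H ^ r.+1 <= H ^ m] since r < m. *)
have qH : (\prod_(i < \rank B) (m * H * E) < H ^ m)%N.
  rewrite prod_nat_const card_ord mulnAC expnMn.
  have h1 : ((m * E) ^ \rank B < H)%N by rewrite ltnS leq_pexp2l ?muln_gt0 ?m0 // ltnW.
  apply: (@leq_trans (H * H ^ \rank B)); first by rewrite ltn_mul2r h1 expn_gt0.
  by rewrite -expnS leq_pexp2l.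
have q0 (i : 'I_(\rank B)) : (0 < m * H * E)%N by rewrite !muln_gt0 m0 E0.
have [v [v0 vH vd]] := siegel_mod (fun i j => a (f i) j) q0 qH.
exists v; split=> //.
have fv i : \sum_j a (f i) j * v j = 0.
  have := vd i; have : `|\sum_j a (f i) j * v j| < (m * H * E)%:Z.
    apply: le_lt_trans (ler_norm_sum _ _ _) _.
    apply: (@le_lt_trans _ _ (\sum_(j : J) (E * (H - 1))%:Z)).
      apply: ler_sum => j _; rewrite normrM PoszM ler_pM //.
      by have := vH j; rewrite /H; lia.
    rewrite sumr_const -/m -mulr_natr natz -PoszM ltz_nat mulnC -mulnA ltn_pmul2l // mulnC ltn_pmul2r //.
    by rewrite /H subn1.
  set s := \sum_j _ => sl /dvdzP[k Ek]; move: sl.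
  rewrite Ek normrM (@ger0_norm _ (m * H * E)%:Z) //.
  case: (eqVneq k 0) => [->|k0]; first by rewrite mul0r.
  by rewrite ltNge ler_peMl // -gtz0_ge1 normr_gt0.
pose V : 'cV[rat]_m := \col_k (v (enum_val k))%:~R.
have fV : rowsub f B *m V = 0.
  apply/colP => i; rewrite !mxE -[RHS](mulr0z 1) -[in RHS](fv i) intr_sum sumJ.
  by apply: eq_bigr => k _; rewrite !mxE intrM.
have /submxP[D DB] : (B <= rowsub f B)%MS by rewrite eq_maxrowsub.
have /colP BV : B *m V = 0 by rewrite DB -mulmxA fV mulmx0.
move=> i; have := BV i; rewrite !mxE => h.
apply: (@intr_inj rat); rewrite mulr0z -[RHS]h intr_sum sumJ.
by apply: eq_bigr => k _; rewrite !mxE intrM.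
Qed.

(** * Bounded bidegree, integer coefficients and clearing of denominators *)

(** Upper bounds rather than exact degrees, so that derivatives and reductions mod p keep the same
    pair. *)
Definition bideg (R : nzRingType) (n1 n2 : nat) (G : {poly {poly R}}) :=
  (size G <= n2.+1)%N /\ forall j, (size (G`_j)%R <= n1.+1)%N.

Lemma bideg_ev2 (R : comNzRingType) n1 n2 (G : {poly {poly R}}) x y : bideg n1 n2 G ->
  ev2 G x y = \sum_(k : 'I_n1.+1 * 'I_n2.+1) G`_(k.2)`_(k.1) * (x ^+ k.1 * y ^+ k.2).
Proof.
move=> [s2 s1]; rewrite -(pair_bigA _ (fun i j => G`_(nat_of_ord j)`_(nat_of_ord i) * (x ^+ i * y ^+ j))).
rewrite exchange_big /ev2 (horner_coef_wide _ s2) horner_sum; apply: eq_bigr => j _.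
rewrite -polyC_exp hornerM hornerC (horner_coef_wide _ (s1 _)) big_distrl.
by apply: eq_bigr => i _; rewrite mulrA.
Qed.

(** Siegel's lemma returns a vector indexed by exponent pairs; this turns it into a polynomial. *)
Definition mkpoly n1 n2 (v : 'I_n1.+1 * 'I_n2.+1 -> int) : {poly {poly int}} :=
  \poly_(j < n2.+1) \poly_(i < n1.+1) v (inord i, inord j).

Lemma mkpoly_bideg n1 n2 (v : 'I_n1.+1 * 'I_n2.+1 -> int) : bideg n1 n2 (mkpoly v).
Proof.
split; first exact: size_poly.
by move=> j; rewrite coef_poly; case: ifP; rewrite ?size_poly0 // size_poly.
Qed.

Lemma mkpoly_coef n1 n2 (v : 'I_n1.+1 * 'I_n2.+1 -> int) (k : 'I_n1.+1 * 'I_n2.+1) :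
  (mkpoly v)`_(k.2)`_(k.1) = v k.
Proof. by case: k => i j; rewrite /= !(coef_poly, ltn_ord) !inord_val. Qed.

Lemma mkpoly_norm n1 n2 (v : 'I_n1.+1 * 'I_n2.+1 -> int) (H : nat) :
  (forall k, `|v k| <= H%:Z) -> forall j i, `|(mkpoly v)`_j`_i| <= H%:Z.
Proof.
move=> vH j i; rewrite coef_poly; case: ifP => _; last by rewrite coef0 normr0.
by rewrite coef_poly; case: ifP => _; rewrite ?normr0.
Qed.

Definition castP (R : nzRingType) (G : {poly {poly int}}) : {poly {poly R}} :=
  map_poly (map_poly (intr : int -> R)) G.

Lemma castP_coef (R : nzRingType) G j i : (castP R G)`_j`_i = (G`_j`_i)%:~R.
Proof. by rewrite /castP !coef_map. Qed.

Lemma castP_bideg (R : nzRingType) n1 n2 G : bideg n1 n2 G -> bideg n1 n2 (castP R G).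
Proof.
move=> [s2 s1]; split.
  by rewrite /castP map_polyE; apply: leq_trans (size_Poly _) _; rewrite size_map.
move=> j; rewrite /castP coef_map /= map_polyE; apply: leq_trans (size_Poly _) _.
by rewrite size_map.
Qed.

Lemma castP_deriv (R : nzRingType) G : castP R G^`() = (castP R G)^`().
Proof. by rewrite /castP deriv_map. Qed.

Lemma castP_ev2 (R : comNzRingType) G (x y : int) : ev2 (castP R G) x%:~R y%:~R = (ev2 G x y)%:~R.
Proof.
rewrite /ev2 /castP -(horner_map (intr : int -> R)) /=; congr (_.[_]).
by rewrite -horner_map /= map_polyC.
Qed.

Lemma deriv_bideg (R : nzRingType) n1 n2 (G : {poly {poly R}}) : bideg n1 n2 G -> bideg n1 n2 G^`().
Proof.
move=> [s2 s1]; split => [|j]; apply/leq_sizeP => i hi; rewrite coef_deriv.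
  by rewrite nth_default ?mul0rn // (leq_trans s2 (leqW hi)).
by rewrite coefMn nth_default ?mul0rn // (leq_trans (s1 _) hi).
Qed.

Lemma deriv_norm n1 n2 (G : {poly {poly int}}) (H : nat) : bideg n1 n2 G ->
  (forall j i, `|G`_j`_i| <= H%:Z) -> forall j i, `|(G^`())`_j`_i| <= (n2 * H)%:Z.
Proof.
move=> [s2 _] GH j i; rewrite coef_deriv coefMn normrMn.
have [jn|jn] := ltnP j n2; last first.
  have -> : G`_j.+1 = 0 by rewrite nth_default // (leq_trans s2).
  by rewrite coef0 normr0 mul0rn.
by rewrite -mulr_natr natz PoszM mulrC ler_pM.
Qed.

(* [b ^ n1 * d ^ n2 * G (a / b, c / d)], cleared of denominators. *)
Definition hom n1 n2 (G : {poly {poly int}}) (a b c d : int) : int :=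
  \sum_(k : 'I_n1.+1 * 'I_n2.+1)
    G`_(k.2)`_(k.1) * ((a ^+ k.1 * b ^+ (n1 - k.1)) * (c ^+ k.2 * d ^+ (n2 - k.2))).

Lemma exprB_ord (R : nzRingType) (x : R) n (i : 'I_n.+1) : x ^+ n = x ^+ (n - i) * x ^+ i.
Proof. by rewrite -exprD subnK // -ltnS ltn_ord. Qed.

(** Stated over any field: over [rat] it links an integer to vanishing at a rational point, over
    ['F_p] to vanishing of the reduction. *)
Lemma hom_ev2 (F : fieldType) n1 n2 G (a b c d : int) : bideg n1 n2 G ->
  b%:~R != 0 :> F -> d%:~R != 0 :> F ->
  (hom n1 n2 G a b c d)%:~R =
    b%:~R ^+ n1 * d%:~R ^+ n2 * ev2 (castP F G) (a%:~R / b%:~R) (c%:~R / d%:~R).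
Proof.
move=> Gb b0 d0; rewrite (bideg_ev2 _ _ (castP_bideg F Gb)) intr_sum mulr_sumr.
apply: eq_bigr => -[i j] _ /=; rewrite castP_coef !(intrM, rmorphXn) /= !expr_div_n.
rewrite (exprB_ord (b%:~R : F) i) (exprB_ord (d%:~R : F) j).
have bi : (b%:~R : F) ^+ i != 0 by rewrite expf_neq0.
have dj : (d%:~R : F) ^+ j != 0 by rewrite expf_neq0.
by field; apply/andP; split; [exact: dj | exact: bi].
Qed.

Lemma dvdz_subM (m x y z w : int) : (m %| x - y)%Z -> (m %| z - w)%Z -> (m %| x * z - y * w)%Z.
Proof.
move=> h1 h2; have -> : x * z - y * w = x * (z - w) + (x - y) * w by ring.
by apply: rpredD; [exact: dvdz_mull | exact: dvdz_mulr].
Qed.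

Lemma dvdz_subX (m x y : int) n : (m %| x - y)%Z -> (m %| x ^+ n - y ^+ n)%Z.
Proof.
by move=> h; elim: n => [|n IHn]; rewrite ?expr0 ?subrr ?dvdz0 // !exprS dvdz_subM.
Qed.

(** The counterpart of [hom_ev2] modulo an integer [m], such as a prime power, with [x] and [y]
    standing for [a / b] and [c / d]. *)
Lemma dvdz_hom (m : int) n1 n2 G (a b c d x y : int) : bideg n1 n2 G ->
  (m %| x * b - a)%Z -> (m %| y * d - c)%Z ->
  (m %| b ^+ n1 * d ^+ n2 * ev2 G x y - hom n1 n2 G a b c d)%Z.
Proof.
move=> Gb ha hc; have -> : b ^+ n1 * d ^+ n2 * ev2 G x y = hom n1 n2 G (x * b) b (y * d) d.
  rewrite (bideg_ev2 _ _ Gb) mulr_sumr; apply: eq_bigr => -[i j] _ /=.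
  rewrite (exprB_ord b i) (exprB_ord d j) !exprMn.
  by ring.
rewrite -sumrB; apply: rpred_sum => -[i j] _ /=.
by rewrite !dvdz_subM ?dvdz_subX ?subrr ?dvdz0.
Qed.

Lemma dvdz_ev2 (m : int) G (x y x0 y0 : int) :
  (m %| x - x0)%Z -> (m %| y - y0)%Z -> (m %| ev2 G x y - ev2 G x0 y0)%Z.
Proof.
(* Any bidegree bound serves to reduce the claim to monomials. *)
move=> hx hy; have Gb : bideg (\max_(j < size G) size (G`_j)%R) (size G) G.
  split=> // j; have [jl|jl] := ltnP j (size G); last by rewrite nth_default ?size_poly0.
  by apply: leqW; exact: (leq_bigmax (Ordinal jl)).
rewrite !(bideg_ev2 _ _ Gb) -sumrB; apply: rpred_sum => k _.
by rewrite !dvdz_subM ?dvdz_subX ?subrr ?dvdz0.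
Qed.

Lemma norm_homog_monomial (x y : int) (B n : nat) (i : 'I_n.+1) :
  `|x| <= B%:Z -> `|y| <= B%:Z -> `|x ^+ i * y ^+ (n - i)| <= (B ^ n)%:Z.
Proof.
move=> hx hy; have -> : (B ^ n)%:Z = B%:Z ^+ i * B%:Z ^+ (n - i).
  by rewrite mulrC -exprB_ord -natz natrX natz.
by rewrite normrM !normrX ler_pM ?exprn_ge0 ?lerXn2r ?nnegrE.
Qed.

Lemma hom_norm n1 n2 (G : {poly {poly int}}) (a b c d : int) (H B1 B2 : nat) :
  (forall j i, `|G`_j`_i| <= H%:Z) ->
  `|a| <= B1%:Z -> `|b| <= B1%:Z -> `|c| <= B2%:Z -> `|d| <= B2%:Z ->
  `|hom n1 n2 G a b c d| <= (n1.+1 * n2.+1 * (H * (B1 ^ n1 * B2 ^ n2)))%:Z.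
Proof.
move=> GH ha hb hc hd.
apply: le_trans (ler_norm_sum _ _ _) _.
have -> : (n1.+1 * n2.+1 * (H * (B1 ^ n1 * B2 ^ n2)))%:Z =
   \sum_(k : 'I_n1.+1 * 'I_n2.+1) (H * (B1 ^ n1 * B2 ^ n2))%:Z.
  by rewrite sumr_const card_prod !card_ord -mulr_natr natz -PoszM mulnC.
apply: ler_sum => -[i j] _ /=; rewrite normrM normrM !PoszM.
by rewrite ler_pM ?mulr_ge0 // ler_pM // norm_homog_monomial.
Qed.

(** * Newton approximation and auxiliary polynomials on a residue class *)

Lemma horner_taylor2 (R : comNzRingType) (q : {poly R}) y e :
  exists r, q.[y - e] = q.[y] - q^`().[y] * e + e ^+ 2 * r.
Proof.
elim/poly_ind: q => [|q c [r E]].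
  by exists 0; rewrite deriv0 !horner0 mul0r mulr0 subr0 addr0.
exists (r * (y - e) + q^`().[y]).
rewrite derivMXaddC !hornerMXaddC hornerD hornerMX E; ring.
Qed.

(* The step [h |-> h - u g(X, h)] is Newton's iteration with the derivative frozen; it is
   a p-adic contraction on the residue class towards the second coordinate. *)
Lemma hensel_approx (g : {poly {poly int}}) (p x0 y0 u : int) K :
  (p %| u * ev2 g^`() x0 y0 - 1)%Z ->
  exists h : {poly int}, forall x y : int, (p %| x - x0)%Z -> (p %| y - y0)%Z ->
    (p ^+ K.+1 %| ev2 g x y)%Z -> (p ^+ K.+1 %| y - h.[x])%Z.
Proof.
move=> hu; elim: K => [|K [h hK]].
  by exists y0%:P => x y _ hy _; rewrite hornerC expr1.
exists (h - u%:P * g.[h]) => x y hx hy hg.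
have {}hK : (p ^+ K.+1 %| y - h.[x])%Z.
  by apply: hK => //; apply: dvdz_trans hg; rewrite [X in (_ %| X)%Z]exprS dvdz_mull.
(* The derivative is constant mod [p] on the class, so [u] inverts it at [(x, y)] too. *)
have {}hu : (p %| 1 - u * ev2 g^`() x y)%Z.
  have -> : 1 - u * ev2 g^`() x y =
    - (u * ev2 g^`() x0 y0 - 1) - u * (ev2 g^`() x y - ev2 g^`() x0 y0) by ring.
  by apply: rpredB; [rewrite rpredN | rewrite dvdz_mull ?dvdz_ev2].
rewrite hornerD hornerN hornerM hornerC.
pose q := map_poly (horner_eval x) g.
have -> : g.[h].[x] = q.[y - (y - h.[x])].
  by rewrite subKr -[LHS]/(horner_eval x _) -horner_map.
set e := y - h.[x] in hK *; have [r ->] := horner_taylor2 q y e.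
(* The three terms are each divisible by one more power of [p] than [e] is known to be: the first by
   [hg], the second by [hu], the third because [e] occurs twice. *)
have -> : y - (h.[x] - u * (q.[y] - q^`().[y] * e + e ^+ 2 * r)) =
   u * q.[y] + (e * (1 - u * q^`().[y]) + (u * r) * (e * e)) by rewrite /e; ring.
move: hg hu; rewrite !ev2_spec -deriv_map -/q => hg hu.
apply: rpredD; first by rewrite dvdz_mull.
apply: rpredD; first by rewrite exprSr dvdz_mul.
apply: dvdz_mull; rewrite exprSr dvdz_mul //.
by apply: dvdz_trans hK; rewrite exprS dvdz_mulr.
Qed.

(* On the class, [G(x, y) = sum_i c_i (x - x0)^i mod p^K.+1] with [c_i] the coefficients of
   [G.[h]] at [x0], so it suffices that [p ^ (K.+1 - i)] divides [c_i]. *)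
Lemma local_auxiliary (g : {poly {poly int}}) (p : nat) (x0 y0 u : int) K H n1 n2 :
  (0 < p)%N -> (p%:Z %| u * ev2 g^`() x0 y0 - 1)%Z ->
  (\prod_(i < K.+1) p ^ (K.+1 - i) < H ^ (n1.+1 * n2.+1))%N ->
  exists G : {poly {poly int}}, [/\ bideg n1 n2 G, G != 0,
    forall j i, `|G`_j`_i| <= H%:Z &
    forall x y : int, (p%:Z %| x - x0)%Z -> (p%:Z %| y - y0)%Z ->
      (p%:Z ^+ K.+1 %| ev2 g x y)%Z -> (p%:Z ^+ K.+1 %| ev2 G x y)%Z].
Proof.
move=> p0 hu hH; have [h hh] := hensel_approx K hu.
pose J : finType := ('I_n1.+1 * 'I_n2.+1)%type.
pose e (k : 'I_n1.+1 * 'I_n2.+1) : {poly int} := 'X^(k.1) * h ^+ k.2.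
(* Taylor coefficients at [x0] of the monomial [k] once X2 is replaced by [h]. *)
pose A (i : 'I_K.+1) (k : 'I_n1.+1 * 'I_n2.+1) := (e k \Po ('X + x0%:P))`_i.
have cJ : #|J| = (n1.+1 * n2.+1)%N by rewrite card_prod !card_ord.
have q0 (i : 'I_K.+1) : (0 < p ^ (K.+1 - i))%N by rewrite expn_gt0 p0.
have [|v [[k vk] vH vA]] := siegel_mod A q0 (H := H); first by rewrite cJ.
exists (mkpoly v); split.
- exact: mkpoly_bideg.
- by apply: contraNneq vk => E; rewrite -mkpoly_coef E !coef0.
- by apply: mkpoly_norm => j; exact: ltW.
move=> x y hx hy hg; have {}hh := hh x y hx hy hg.
have : (p%:Z ^+ K.+1 %| ev2 (mkpoly v) x y - ev2 (mkpoly v) x h.[x])%Z.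
  by rewrite dvdz_ev2 ?subrr ?dvdz0.
suff hd : (p%:Z ^+ K.+1 %| ev2 (mkpoly v) x h.[x])%Z by rewrite rpredBr.
pose P := \sum_k v k *: e k.
have coefP i : (P \Po ('X + x0%:P))`_i = \sum_j v j * (e j \Po ('X + x0%:P))`_i.
  by rewrite raddf_sum coef_sum; apply: eq_bigr => j _; rewrite /= comp_polyZ coefZ.
have -> : ev2 (mkpoly v) x h.[x] = (P \Po ('X + x0%:P)).[x - x0].
  rewrite horner_comp hornerD hornerX hornerC subrK horner_sum (bideg_ev2 _ _ (mkpoly_bideg v)).
  by apply: eq_bigr => j _; rewrite mkpoly_coef hornerZ hornerM hornerXn horner_exp.
rewrite horner_coef; apply: rpred_sum => i _.
(* For [i >= K.+1] the power of [x - x0] alone is divisible by [p ^ K.+1]; for smaller [i] it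
   supplies [p ^ i], and the coefficient supplies the remaining [p ^ (K.+1 - i)]. *)
have [iK|Ki] := ltnP i K.+1; last first.
  apply: dvdz_mull; apply: (@dvdz_trans ((x - x0) ^+ K.+1)).
    elim: K.+1 => [|m IHm]; first by rewrite !expr0.
    by rewrite !exprS dvdz_mul.
  by rewrite -(subnK Ki) exprD dvdz_mull.
have -> : p%:Z ^+ K.+1 = p%:Z ^+ (K.+1 - i) * p%:Z ^+ i by rewrite -exprD subnK // ltnW.
apply: dvdz_mul; last first.
  by elim: (nat_of_ord i) => [|m IHm]; rewrite ?expr0 // !exprS dvdz_mul.
have := vA (Ordinal iK); rewrite -natz natrX natz.
rewrite coefP; congr (_ %| _)%Z; apply: eq_bigr => j _; exact: mulrC.
Qed.

(** * Reduction of rational points mod p and the count by residue classes *)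

Lemma intrFp_eq0 (p : nat) (n : int) : prime p -> (n%:~R == 0 :> 'F_p) = (p%:Z %| n)%Z.
Proof.
move=> pr; have natF m : (m%:R == 0 :> 'F_p) = (p %| m)%N by rewrite (dvdn_pcharf (pchar_Fp pr)).
by rewrite dvdzE absz_nat; case: n => m; rewrite ?NegzE ?mulrNz ?oppr_eq0 ?abszN -pmulrn natF.
Qed.

(** A Bezout relation inverts [b] mod [p ^ K]; so a rational number with denominator prime to [p]
    has an integer representative mod every power of [p]. *)
Lemma exists_lift_mod (p : nat) K (a b : int) : prime p -> ~~ (p%:Z %| b)%Z ->
  exists x, (p%:Z ^+ K %| x * b - a)%Z.
Proof.
move=> pr pb; have /coprimezP[[u v] /= E] : coprimez (p%:Z ^+ K) b.
  by apply: coprimezXl; rewrite coprimezE absz_nat prime_coprime // -dvdzE.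
exists (a * v); have -> : a * v * b - a = - (a * u) * p%:Z ^+ K.
  by rewrite -[X in _ - X]mulr1 -E; ring.
exact: dvdz_mull.
Qed.

(** When [p] divides the denominator, division by zero yields the default value 0; this case is
    excluded wherever reductions are compared. *)
Definition redp (p : nat) (t : rat) : 'F_p := (numq t)%:~R / (denq t)%:~R.

Definition homq n1 n2 (G : {poly {poly int}}) (z : rat * rat) : int :=
  hom n1 n2 G (numq z.1) (denq z.1) (numq z.2) (denq z.2).

Lemma homq_eq0 n1 n2 G z : bideg n1 n2 G ->
  (homq n1 n2 G z == 0) = (ev2 (castP rat G) z.1 z.2 == 0).
Proof.
move=> Gb; have d1 : (denq z.1)%:~R != 0 :> rat by rewrite intr_eq0 denq_neq0.
have d2 : (denq z.2)%:~R != 0 :> rat by rewrite intr_eq0 denq_neq0.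
rewrite -(intr_eq0 rat) /homq (hom_ev2 _ _ Gb d1 d2) !divq_num_den.
by rewrite !mulf_eq0 !expf_eq0 (negPf d1) (negPf d2) !andbF.
Qed.

Lemma homq_redp n1 n2 G z (p : nat) : bideg n1 n2 G -> prime p ->
  ~~ (p%:Z %| denq z.1)%Z -> ~~ (p%:Z %| denq z.2)%Z ->
  (p%:Z %| homq n1 n2 G z)%Z = (ev2 (castP 'F_p G) (redp p z.1) (redp p z.2) == 0).
Proof.
move=> Gb pr; rewrite -!intrFp_eq0 // => d1 d2.
rewrite /homq (hom_ev2 _ _ Gb d1 d2).
by rewrite !mulf_eq0 !expf_eq0 (negPf d1) (negPf d2) !andbF.
Qed.

Lemma castP_neq0 G : G != 0 -> castP rat G != 0.
Proof.
apply: contraNneq => E; apply/eqP/polyP => j; apply/polyP => i.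
by apply/eqP; rewrite !coef0 -(intr_eq0 rat) -castP_coef E !coef0.
Qed.

Definition htle (B1 B2 : nat) (z : rat * rat) :=
  [&& `|numq z.1| <= B1%:Z, `|denq z.1| <= B1%:Z, `|numq z.2| <= B2%:Z & `|denq z.2| <= B2%:Z].

(** The value of the auxiliary [G] at [z], cleared of denominators, is divisible by [p ^ K.+1] and,
    by the second size hypothesis, smaller than that in absolute value; so it is zero. *)
Lemma class_auxiliary (p : nat) (g : {poly {poly int}}) (n1 n2 m1 m2 K H B1 B2 : nat)
    (xi eta : 'F_p) :
  prime p -> bideg n1 n2 g -> ev2 (castP 'F_p g^`()) xi eta != 0 ->
  (\prod_(i < K.+1) p ^ (K.+1 - i) < H ^ (m1.+1 * m2.+1))%N ->
  (m1.+1 * m2.+1 * (H * (B1 ^ m1 * B2 ^ m2)) < p ^ K.+1)%N ->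
  exists G : {poly {poly int}}, [/\ bideg m1 m2 G, G != 0 & forall z,
    htle B1 B2 z -> homq n1 n2 g z = 0 ->
    ~~ (p%:Z %| denq z.1)%Z -> ~~ (p%:Z %| denq z.2)%Z ->
    redp p z.1 = xi -> redp p z.2 = eta -> ev2 (castP rat G) z.1 z.2 = 0].
Proof.
move=> pr gb hd hH hK.
have liftF (x : 'F_p) : exists n : int, n%:~R = x.
  by exists (val x)%:Z; rewrite -pmulrn natr_Zp.
have [[x0 Ex0] [y0 Ey0]] := (liftF xi, liftF eta).
have [u Eu] := liftF (ev2 (castP 'F_p g^`()) xi eta)^-1.
have hu : (p%:Z %| u * ev2 g^`() x0 y0 - 1)%Z.
  rewrite -intrFp_eq0 // rmorphB rmorphM /= -castP_ev2 Ex0 Ey0 Eu mulVf // rmorph1 subrr.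
  by [].
have [G [Gb G0 GH hG]] := local_auxiliary (prime_gt0 pr) hu hH.
exists G; split=> // z /and4P[h1 h2 h3 h4] gz pd1 pd2 Exi Eeta.
have [x hx] := exists_lift_mod K.+1 (numq z.1) pr pd1.
have [y hy] := exists_lift_mod K.+1 (numq z.2) pr pd2.
have pK (w : int) : (p%:Z ^+ K.+1 %| w)%Z -> (p%:Z %| w)%Z.
  by apply: dvdz_trans; rewrite exprS dvdz_mulr.
(* An integer representing a coordinate mod [p ^ K.+1] lies in the residue class prescribed by [xi]
   or [eta]. *)
have cong (t : rat) (w w0 : int) : ~~ (p%:Z %| denq t)%Z -> redp p t = w0%:~R ->
    (p%:Z ^+ K.+1 %| w * denq t - numq t)%Z -> (p%:Z %| w - w0)%Z.
  move=> dt Ew /pK; rewrite -!intrFp_eq0 // in dt *.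
  rewrite !rmorphB rmorphM /= -Ew /redp !subr_eq0 => /eqP <-.
  by rewrite mulfK.
have hx0 : (p%:Z %| x - x0)%Z by apply: cong pd1 _ hx; rewrite Ex0.
have hy0 : (p%:Z %| y - y0)%Z by apply: cong pd2 _ hy; rewrite Ey0.
(* The denominators are invertible mod [p ^ K.+1], so the vanishing of [homq n1 n2 g z] passes to
   [ev2 g x y]. *)
have cop a b : coprimez (p%:Z ^+ K.+1) (denq z.1 ^+ a * denq z.2 ^+ b).
  apply: coprimezXl; rewrite coprimezMr; apply/andP; split; apply: coprimezXr;
    by rewrite coprimezE absz_nat prime_coprime // -dvdzE.
have hg : (p%:Z ^+ K.+1 %| ev2 g x y)%Z.
  have := dvdz_hom gb hx hy; rewrite -/(homq n1 n2 g z) gz subr0.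
  by rewrite Gauss_dvdzr.
have /(dvdz_mull (denq z.1 ^+ m1 * denq z.2 ^+ m2)) := hG x y hx0 hy0 hg.
have := dvdz_hom Gb hx hy => h5 h6.
have {h5 h6} : (p%:Z ^+ K.+1 %| hom m1 m2 G (numq z.1) (denq z.1) (numq z.2) (denq z.2))%Z.
  by move: h5; rewrite rpredBl.
move=> hdiv; apply/eqP; rewrite -(homq_eq0 _ Gb); apply/eqP.
have := hom_norm m1 m2 GH h1 h2 h3 h4.
case/dvdzP: hdiv => q; rewrite /homq => -> hle.
have [->|q0] := eqVneq q 0; first by rewrite mul0r.
have : (p ^ K.+1)%:Z <= `|q * p%:Z ^+ K.+1|.
  rewrite normrM -[(p ^ K.+1)%:Z]natz natrX natz (@ger0_norm _ (_ ^+ _)) ?exprn_ge0 //.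
  by rewrite ler_peMl ?exprn_ge0 // -gtz0_ge1 normr_gt0.
by move=> /le_trans/(_ hle); rewrite lez_nat leqNgt hK.
Qed.

Lemma castP_size G : size (castP rat G) = size G.
Proof.
rewrite /castP size_map_inj_poly ?rmorph0 // => p q E; apply/polyP => i.
by apply/eqP; rewrite -(eqr_int rat) -!coef_map E.
Qed.

(** At most [p * n2] classes are occupied, and on each one [bezout_bound] applies to [f] and the
    auxiliary [G]. The latter has degree at most [m2] in X2, below that of [f]; [m] bounds both
    degrees in X1. *)
Lemma good_points_leq (f g : {poly {poly int}}) (p n1 n2 m1 m2 m K H B1 B2 : nat)
    (s : seq (rat * rat)) :
  irreducible_elt (castP rat f) -> bideg m m2.+1 f -> (m1 <= m)%N -> size f = m2.+2 ->
  prime p -> bideg n1 n2 g ->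
  (\prod_(i < K.+1) p ^ (K.+1 - i) < H ^ (m1.+1 * m2.+1))%N ->
  (m1.+1 * m2.+1 * (H * (B1 ^ m1 * B2 ^ m2)) < p ^ K.+1)%N ->
  uniq s ->
  (forall z, z \in s -> [/\ htle B1 B2 z, ev2 (castP rat f) z.1 z.2 = 0, homq n1 n2 g z = 0 &
    [&& ~~ (p%:Z %| denq z.1)%Z, ~~ (p%:Z %| denq z.2)%Z &
        ~~ (p%:Z %| homq n1 n2 g^`() z)%Z]]) ->
  (size s <= p * n2 * (2 * m2.+1 * m * m2.+1))%N.
Proof.
move=> firr fb mm sf pr gb hH hK us hs.
pose phi (z : rat * rat) := (redp p z.1, redp p z.2).
apply: leq_trans (size_fiber_leq (phi := phi) (B := 2 * m2.+1 * m * m2.+1) _) _.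
  move=> [xi eta]; set t := [seq _ <- _ | _].
  (* An empty class is trivial; a point of a nonempty one certifies that the derivative of [g] is
     nonzero there. *)
  case Et: t => [//|z0 t']; rewrite -Et.
  have : z0 \in t by rewrite Et mem_head.
  rewrite mem_filter => /andP[/eqP[E1 E2]] /hs[_ _ _ /and3P[h1 h2]].
  rewrite (homq_redp (deriv_bideg gb) pr h1 h2) E1 E2 => hd.
  have [G [Gb G0 hG]] := class_auxiliary pr gb hd hH hK.
  have [Gs Gc] := castP_bideg rat Gb; have [_ fc] := castP_bideg rat fb.
  have := @bezout_bound (castP rat f) (castP rat G) m t firr (castP_neq0 G0).
  rewrite (castP_size f) sf /=; apply => //.
  - by move=> j; apply: leq_trans (Gc j) _.
  - by rewrite filter_uniq.
  - move=> z; rewrite mem_filter => /andP[/eqP[e1 e2]] /hs[k1 k2 k3 /and3P[k4 k5 _]].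
    by split=> //; apply: hG.
rewrite leq_mul2r; apply/orP; right.
apply: leq_trans (size_fiber_leq (phi := fst) (B := n2) _) _.
  move=> xi; set t := [seq _ <- _ | _].
  case Et: t => [//|[xi0 eta] t'].
  rewrite -Et -(size_map snd); set q := map_poly (horner_eval xi) (castP 'F_p g).
  have ht w : w \in t -> w.1 = xi /\ root q w.2 /\ q^`().[w.2] != 0.
    rewrite mem_filter mem_undup => /andP[/eqP E /mapP[z /hs[_ _ gz /and3P[h1 h2 h3]] Ew]].
    split=> //; have := homq_redp (deriv_bideg gb) pr h1 h2.
    rewrite (negPf h3) castP_deriv ev2_spec -deriv_map.
    have := homq_redp gb pr h1 h2; rewrite gz dvdz0 => /esym/eqP.
    rewrite ev2_spec; move: E; rewrite Ew /= => -> h4 /esym/negbT h5.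
    by split=> //; apply/rootP.
  (* A nonzero derivative at one root shows that the specialization [q] is nonzero, so it has at
     most [n2] roots. *)
  have q0 : q != 0.
    have [|_ [_]] := ht (xi0, eta); first by rewrite Et mem_head.
    by apply: contraNneq => ->; rewrite deriv0 horner0.
  have sq : (size q <= n2.+1)%N.
    rewrite /q map_polyE; apply: leq_trans (size_Poly _) _; rewrite size_map.
    exact: (castP_bideg _ gb).1.
  rewrite -ltnS; apply: leq_trans sq; apply: max_poly_roots => //.
    by apply/allP => y /mapP[w /ht[_ [h _]] ->].
  by apply: uniq_fst_fiber; exact: undup_uniq.
rewrite leq_mul2r; apply/orP; right.
rewrite -[X in (_ <= X)%N](card_Fp pr); set t := undup _.
by have /card_uniqP <- : uniq t by [exact: undup_uniq]; exact: max_card.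
Qed.

(** * Replacing [f] by a polynomial with small coefficients *)

(* [f] only witnesses that the evaluation conditions are not of full rank. *)
Lemma small_vanishing_poly (f : {poly {poly int}}) n1 n2 (B1 B2 : nat) (s : seq (rat * rat)) :
  (0 < B1)%N -> (0 < B2)%N -> f != 0 -> bideg n1 n2 f ->
  (forall z, z \in s -> htle B1 B2 z /\ ev2 (castP rat f) z.1 z.2 = 0) ->
  exists g : {poly {poly int}}, [/\ bideg n1 n2 g, g != 0,
    forall j i, `|g`_j`_i| <= ((n1.+1 * n2.+1 * (B1 ^ n1 * B2 ^ n2)) ^ (n1.+1 * n2.+1)).+1%:Z
    & forall z, z \in s -> homq n1 n2 g z = 0].
Proof.
move=> B10 B20 f0 fb hs.
pose pt (i : 'I_(size s)) := nth (0, 0) s i.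
have ps i : pt i \in s by rewrite mem_nth.
(* Row [i] holds the monomials at the [i]-th point, cleared of denominators, so that [homq] is this
   row applied to the coefficients. *)
pose a (i : 'I_(size s)) (k : 'I_n1.+1 * 'I_n2.+1) : int :=
  (numq (pt i).1 ^+ k.1 * denq (pt i).1 ^+ (n1 - k.1)) *
  (numq (pt i).2 ^+ k.2 * denq (pt i).2 ^+ (n2 - k.2)).
pose w (k : 'I_n1.+1 * 'I_n2.+1) : rat := (f`_(k.2)`_(k.1))%:~R.
have [k0 wk0] : exists k, w k != 0.
  apply/existsP; apply: contraNT f0; rewrite negb_exists => /forallP h.
  apply/eqP/polyP => j; apply/polyP => i; rewrite !coef0.
  have [jn|jn] := ltnP j n2.+1; last first.
    by have -> : f`_j = 0 by [rewrite nth_default // (leq_trans fb.1)]; rewrite coef0.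
  have [il|il] := ltnP i n1.+1; last by rewrite nth_default // (leq_trans (fb.2 j)).
  by have := h (Ordinal il, Ordinal jn); rewrite negbK intr_eq0 => /eqP.
have aE i k : `|a i k| <= (B1 ^ n1 * B2 ^ n2)%:Z.
  have [/and4P[h1 h2 h3 h4] _] := hs _ (ps i).
  by rewrite normrM PoszM ler_pM // norm_homog_monomial.
have E0 : (0 < B1 ^ n1 * B2 ^ n2)%N by rewrite muln_gt0 !expn_gt0 B10 B20.
have aw i : \sum_k (a i k)%:~R * w k = 0.
  have [_ /eqP] := hs _ (ps i); rewrite -(homq_eq0 _ fb) => /eqP E.
  rewrite -[RHS](mulr0z 1) -[in RHS]E intr_sum.
  by apply: eq_bigr => k _; rewrite [in RHS]intrM mulrC.
have [v [[k vk] vH va]] := siegel_small E0 aE wk0 aw.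
exists (mkpoly v); split.
- exact: mkpoly_bideg.
- by apply: contraNneq vk => E; rewrite -mkpoly_coef E !coef0.
- by apply: mkpoly_norm => j; have := vH j; rewrite card_prod !card_ord; exact: ltW.
move=> z zs; have iz : (index z s < size s)%N by rewrite index_mem.
have := va (Ordinal iz); rewrite /a /pt /= nth_index // => <-.
by apply: eq_bigr => j _; rewrite mkpoly_coef mulrC.
Qed.

(** * Averaging over primes and Chebyshev's lower bound *)

Lemma prod_primes_dvdn (S : seq nat) (M : nat) :
  uniq S -> (forall p, p \in S -> prime p && (p %| M)%N) -> (\prod_(p <- S) p %| M)%N.
Proof.
elim: S => [|p S IHS] /=; first by rewrite big_nil dvd1n.
move=> /andP[pS uS] h; rewrite big_cons Gauss_dvd.
  have /andP[_ ->] := h p (mem_head _ _); apply: IHS => // q qS.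
  by apply: h; rewrite inE qS orbT.
rewrite big_seq; elim/big_rec: _ => [|q x qS cx]; first by rewrite coprimen1.
rewrite coprimeMr cx andbT.
have /andP[pp _] := h p (mem_head _ _).
have /andP[pq _] : prime q && (q %| M)%N by apply: h; rewrite inE qS orbT.
by rewrite prime_coprime // dvdn_prime2 //; apply: contraNneq pS => ->.
Qed.

(** Otherwise every [p] in [S] divides [M z] for at least half of the points. Double counting the
    pairs with [p %| M z] gives [(\prod_(p <- S) p) ^ size s <= (X ^ 2) ^ size s], against the size
    of the product. *)
Lemma exists_good_prime (T : eqType) (s : seq T) (M : T -> nat) (X : nat) (S : seq nat) :
  (0 < X)%N -> (forall z, z \in s -> (0 < M z <= X)%N) -> uniq S -> all prime S ->
  (X ^ 2 < \prod_(p <- S) p)%N ->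
  exists2 p, p \in S & (size s <= 2 * count (fun z => ~~ (p %| M z)%N) s)%N.
Proof.
move=> X0 hM uS /allP prS hX.
have [/hasP[p pS hp]|/hasPn hn] :=
  boolP (has (fun p => size s <= 2 * count (fun z => ~~ (p %| M z)%N) s)%N S); first by exists p.
exfalso; pose bad p := count (fun z => p %| M z)%N s.
have hb p : p \in S -> (size s <= 2 * bad p)%N.
  move=> /hn; rewrite -ltnNge /bad; have := count_predC (fun z => p %| M z)%N s.
  set x := count (predC _) s; rewrite -/x; move: x (count _ s) => x y; lia.
have E : (\prod_(p <- S) p ^ bad p = \prod_(z <- s) \prod_(p <- S | p %| M z) p)%N.
  rewrite [RHS](exchange_big_dep xpredT) //=; apply: eq_bigr => p _.
  by rewrite -big_filter big_const_seq count_predT size_filter iter_muln_1.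
have h1 : (\prod_(z <- s) \prod_(p <- S | p %| M z) p <= X ^ size s)%N.
  rewrite -(count_predT s) -iter_muln_1 -big_const_seq !big_seq.
  apply: leq_prod => z zs; have /andP[M0 MX] := hM z zs.
  apply: leq_trans MX; apply: dvdn_leq => //; rewrite -big_filter.
  apply: prod_primes_dvdn; first by rewrite filter_uniq.
  by move=> p; rewrite mem_filter => /andP[-> /prS ->].
have h2 : ((\prod_(p <- S) p) ^ size s <= (X ^ 2) ^ size s)%N.
  rewrite -expnM mulnC expnM; apply: (@leq_trans ((\prod_(p <- S) p ^ bad p) ^ 2)); last first.
    by rewrite E leq_exp2r // mulnC expnM in h1 *.
  have pe F e : ((\prod_(p <- S) F p) ^ e = \prod_(p <- S) F p ^ e)%N.
    by apply: (big_morph (fun x => x ^ e)%N) => [x y|]; rewrite ?expnMn ?exp1n.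
  rewrite !pe.
  rewrite !big_seq; apply: leq_prod => p pS; rewrite -expnM mulnC leq_pexp2l ?hb //.
  by rewrite prime_gt0 // prS.
(* An empty [s] accepts every prime, so only an empty [S] must be refuted: its product is 1, not
   above [X ^ 2]. *)
case: s hM hn bad hb E h1 h2 => [|z s] hM hn bad hb E h1 h2.
  case: S hX hn {uS prS hb E h1 h2} => [|p S] hX hn; last by have := hn p (mem_head _ _).
  by move: hX; rewrite big_nil ltnS leqn0 expn_eq0 -leqn0 leqNgt X0.
by move: h2; rewrite leq_exp2r // leqNgt hX.
Qed.

(** By Pascal's rule and symmetry the central coefficient at least doubles at each step. *)
Lemma leq_exp2_central_bin n : (2 ^ n <= 'C(2 * n, n))%N.
Proof.
elim: n => // n IHn; have -> : (2 * n.+1 = (2 * n).+2)%N by lia.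
rewrite binS; have -> : 'C((2 * n).+1, n) = 'C((2 * n).+1, n.+1).
  by rewrite -(@bin_sub (2 * n).+1 n.+1) ?subSS; [congr 'C(_, _) |]; lia.
rewrite addnn -mul2n expnS leq_mul2l /=; apply: leq_trans IHn _.
by rewrite binS leq_addl.
Qed.

(** By Legendre's formula the exponent is a sum over k of differences of floors, each 0 or 1, and 0
    once [p ^ k] exceeds [2 * n]. *)
Lemma logn_central_bin p n : prime p -> (0 < n)%N -> (p ^ logn p 'C(2 * n, n) <= 2 * n)%N.
Proof.
move=> pr n0; have p1 := prime_gt1 pr.
suff h : (logn p 'C(2 * n, n) <= trunc_log p (2 * n))%N.
  apply: leq_trans (trunc_logP p1 _); last by rewrite muln_gt0.
  by rewrite leq_exp2l.
have C0 : (0 < 'C(2 * n, n))%N by rewrite bin_gt0; lia.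
have E : (logn p (2 * n)`! = logn p 'C(2 * n, n) + 2 * logn p n`!)%N.
  rewrite -(@bin_fact (2 * n) n); last by lia.
  by rewrite (_ : 2 * n - n = n)%N ?lognM ?muln_gt0 ?fact_gt0 //; lia.
(* The sum for [n] is padded with zero terms to the range of the sum for [2 * n]. *)
have En : logn p n`! = (\sum_(1 <= k < (2 * n).+1) n %/ p ^ k)%N.
  rewrite logn_fact // (@big_cat_nat _ _ _ n.+1 1 (2 * n).+1) //=; last by lia.
  rewrite [X in (_ = _ + X)%N]big_nat_cond [X in (_ = _ + X)%N]big1 ?addn0 // => k /andP[/andP[nk _] _].
  by rewrite divn_small // (ltn_trans nk) // ltn_expl.
have h1 : (logn p 'C(2 * n, n) <= \sum_(1 <= k < (2 * n).+1) (p ^ k <= 2 * n))%N.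
  rewrite -(leq_add2r (2 * logn p n`!)) -E En big_distrr /= -big_split /= logn_fact //.
  apply: leq_sum => k _; have pk0 : (0 < p ^ k)%N by rewrite expn_gt0 ltnW.
  have [h|h] := leqP (p ^ k) (2 * n); last by rewrite divn_small.
  rewrite -ltnS ltn_divLR //; have := ltn_ceil n pk0; lia.
apply: leq_trans h1 _; set e := trunc_log p (2 * n).
apply: (@leq_trans (\sum_(1 <= k < (2 * n).+1) (k <= e))).
  apply: leq_sum => k _; case: (leqP (p ^ k) (2 * n)) => // h.
  by rewrite /e trunc_log_max.
have [h|h] := leqP e (2 * n); last first.
  apply: (@leq_trans (\sum_(1 <= k < (2 * n).+1) 1)); first by apply: leq_sum => k _; exact: leq_b1.
  by rewrite sum_nat_const_nat; lia.
rewrite (@big_cat_nat _ _ _ e.+1) //= [X in (_ + X <= _)%N]big_nat_cond.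
rewrite [X in (_ + X <= _)%N]big1 ?addn0; last by move=> k /andP[/andP[ek _] _]; rewrite leqNgt ek.
apply: (@leq_trans (\sum_(1 <= k < e.+1) 1)); first by apply: leq_sum => k _; exact: leq_b1.
by rewrite sum_nat_const_nat; lia.
Qed.

(* Chebyshev: for [p > Q] the exponent of p in 'C(2n, n) is at most 1, and the primes
   [p <= Q] contribute at most 2n each. *)
Lemma prod_primes_geq (n Q : nat) : (0 < n)%N -> (2 * n <= Q ^ 2)%N ->
  exists S : seq nat, [/\ uniq S, all prime S, forall p, p \in S -> (Q < p <= 2 * n)%N
    & (2 ^ n <= (2 * n) ^ Q * \prod_(p <- S) p)%N].
Proof.
move=> n0 hQ; set C := 'C(2 * n, n).
have C0 : (0 < C)%N by rewrite bin_gt0; lia.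
exists [seq p <- primes C | (Q < p)%N]; split.
- by rewrite filter_uniq ?primes_uniq.
- by apply/allP => p; rewrite mem_filter mem_primes => /andP[_ /andP[]].
- move=> p; rewrite mem_filter mem_primes => /andP[-> /and3P[pr _ pC]] /=.
  have : (p %| (2 * n)`!)%N.
    by apply: dvdn_trans pC _; rewrite -(@bin_fact (2 * n) n) ?dvdn_mulr //; lia.
  rewrite fact_prod big_nat => h; rewrite leqNgt; apply/negP => hp; move: h.
  apply/negP; rewrite -big_nat -fact_prod; have := logn_fact (2 * n) pr.
  rewrite big_nat big1 => [h0|k /andP[k1 _]].
    apply/negP => hd; have := pfactor_dvdn 1 pr (fact_gt0 (2 * n)).
    by rewrite expn1 hd h0.
  by rewrite divn_small //; apply: leq_trans hp _; rewrite -{1}(expn1 p) leq_pexp2l // prime_gt0.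
apply: leq_trans (leq_exp2_central_bin n) _; rewrite -/C.
rewrite [X in (X <= _)%N](_ : C = \prod_(p <- primes C) p ^ logn p C)%N; last first.
  by rewrite {1}(prod_prime_decomp C0) prime_decompE big_map.
rewrite (bigID (fun p => p <= Q)%N) /= big_filter; apply: leq_mul.
  apply: (@leq_trans (\prod_(p <- primes C | (p <= Q)%N) (2 * n))).
    rewrite big_seq_cond [X in (_ <= X)%N]big_seq_cond; apply: leq_prod => p /andP[].
    by rewrite mem_primes => /andP[pr _] _; exact: logn_central_bin.
  rewrite -big_filter big_const_seq count_predT iter_muln_1 leq_pexp2l ?muln_gt0 //.
  rewrite -[X in (_ <= X)%N](size_iota 1 Q); apply: uniq_leq_size.
    by rewrite filter_uniq ?primes_uniq.
  move=> p; rewrite mem_filter mem_primes mem_iota => /andP[pQ /andP[pr _]].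
  by rewrite add1n ltnS pQ prime_gt0.
under eq_bigl do rewrite -ltnNge.
rewrite big_seq_cond [X in (_ <= X)%N]big_seq_cond; apply: leq_prod => p /andP[].
rewrite mem_primes => /andP[pr _] Qp; have := logn_central_bin pr n0; rewrite -/C.
have p0 := prime_gt0 pr; have p1 := prime_gt1 pr.
case: (logn p C) => [|[|e]] // h; exfalso; move: h; apply/negP; rewrite -ltnNge.
apply: (@leq_trans (p ^ 2)); last by rewrite leq_exp2l.
by apply: leq_ltn_trans hQ _; rewrite ltn_exp2r.
Qed.

Lemma leq_expn_base a b e : (a <= b -> a ^ e <= b ^ e)%N.
Proof. by case: e => // e h; rewrite leq_exp2r. Qed.

(** This is [prod_primes_geq] with [n = 2 * t ^ 2] and [Q = P + 2 * t]. Of the exponent [2 * t ^ 2]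
    of 2, the factor [(2 * n) ^ Q] takes at most [2 * u * P + t ^ 2], and more than [Y] is left. *)
Lemma exists_many_primes (t u P Y : nat) :
  (32 <= t)%N -> (2 * t <= 2 ^ u)%N -> (2 * u * P + Y < t ^ 2)%N ->
  exists S : seq nat, [/\ uniq S, all prime S, forall p, p \in S -> (P < p <= 4 * t ^ 2)%N
    & (2 ^ Y < \prod_(p <- S) p)%N].
Proof.
move=> t32 hu hY.
have [| |S [uS pS hS hp]] := @prod_primes_geq (2 * t ^ 2) (P + 2 * t); [by nia..|].
exists S; split=> //.
  by move=> p /hS /andP[h1 h2]; apply/andP; split; lia.
(* At [t = 32] this reads [2 ^ 24 <= 2 ^ 32]; beyond, the left side grows by a factor below 2 at
   each step. *)
have t4 : ((2 * t) ^ 4 <= 2 ^ t)%N.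
  have [k ->] : exists k, t = (32 + k)%N by exists (t - 32)%N; lia.
  have e64 : (2 * 32 = 2 ^ 6)%N by [].
  elim: k => [|k IHk]; first by rewrite addn0 e64 -expnM leq_exp2l.
  rewrite addnS [X in (_ <= X)%N]expnS; apply: leq_trans (leq_mul (leqnn 2) IHk).
  move: (32 + k)%N (leq_addr k 32) => a a32; have sq (x : nat) : ((2 * x) ^ 4 = 16 * (x ^ 2 * x ^ 2))%N.
    by rewrite expnMn -expnD.
  rewrite !sq; have : (4 * a.+1 ^ 2 <= 5 * a ^ 2)%N by rewrite -!mulnn; nia.
  by move: (a.+1 ^ 2)%N (a ^ 2)%N => y z; nia.
have h2 : ((2 * (2 * t ^ 2)) ^ (P + 2 * t) <= 2 ^ (2 * u * P + t ^ 2))%N.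
  have -> : (2 * (2 * t ^ 2) = (2 * t) ^ 2)%N by lia.
  rewrite -expnM (_ : 2 * (P + 2 * t) = 2 * P + 4 * t)%N; last by lia.
  rewrite (expnD _ (2 * P)) (expnD _ (2 * u * P)); apply: leq_mul.
    have -> : (2 * u * P = u * (2 * P))%N by lia.
    by rewrite [X in (_ <= X)%N]expnM leq_expn_base.
  by rewrite expnM -[(t ^ 2)%N]mulnn [X in (_ <= X)%N]expnM leq_expn_base.
rewrite -(@ltn_pmul2l (2 ^ (2 * u * P + t ^ 2))) ?expn_gt0 //.
apply: (@leq_trans (2 ^ (2 * t ^ 2))); first by rewrite -expnD ltn_exp2l //; lia.
by apply: leq_trans hp _; rewrite leq_mul2r h2 orbT.
Qed.

(** * Exponent bookkeeping and the bound in the main range *)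

(** The product of the moduli in [local_auxiliary] when [K.+1 = 2 * e]. *)
Lemma prod_expn_desc p e : (\prod_(i < 2 * e) p ^ (2 * e - i) = p ^ (e * (2 * e).+1))%N.
Proof.
elim: e => [|e IHe]; first by rewrite big_ord0.
rewrite (_ : 2 * e.+1 = (2 * e).+2)%N; last by lia.
rewrite 2!big_ord_recl /= (eq_bigr (fun i : 'I_(2 * e) => p ^ (2 * e - i))%N) // IHe.
rewrite -!expnD; congr (_ ^ _)%N; rewrite /bump /=; nia.
Qed.

Lemma bezout_int (f G : {poly {poly int}}) (d m : nat) (s : seq (rat * rat)) :
  irreducible_elt (castP rat f) -> bideg m d f -> size f = d.+1 ->
  G != 0 -> (size G <= d)%N -> (forall j, size (G`_j)%R <= m.+1)%N -> uniq s ->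
  (forall z, z \in s -> ev2 (castP rat f) z.1 z.2 = 0 /\ ev2 (castP rat G) z.1 z.2 = 0) ->
  (size s <= 2 * d * m * d)%N.
Proof.
move=> firr fb sf G0 sG hG us hs; have [_ fc] := castP_bideg rat fb.
have Gb : bideg m d G by split => //; exact: leqW.
have [_ Gc] := castP_bideg rat Gb.
have := bezout_bound firr (castP_neq0 G0) _ fc Gc us hs.
by rewrite !castP_size sf; apply.
Qed.

(** The left side bounds the integer that a good prime must not divide: two denominators times the
    derivative of [g], cleared of denominators. Each factor is at most 2 to a multiple of [L], and
    the summands on the right follow the factors in order. *)
Lemma bad_modulus_exponent (d1 d2 L b1 b2 : nat) :
  let D := (d1.+1 * d2.+1)%N in let w := (d1 * d2 + d2)%N in
  (0 < L)%N -> (b1 <= 2 ^ (d2 * L))%N -> (b2 <= 2 ^ L)%N ->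
  (b1 * b2 * (D * (d2 * ((D * (b1 ^ d1 * b2 ^ d2)) ^ D).+1 * (b1 ^ d1 * b2 ^ d2))) <=
    2 ^ ((d2 + 1 + (D + (d2 + ((D + w) * D + 1) + w))) * L))%N.
Proof.
move=> D w L0 h1 h2.
have small a : (a <= 2 ^ (a * L))%N.
  by apply: leq_trans (ltnW (ltn_expl a (ltnSn 1))) _; rewrite leq_exp2l // leq_pmulr.
have hw : (b1 ^ d1 * b2 ^ d2 <= 2 ^ (w * L))%N.
  rewrite (_ : w * L = d2 * L * d1 + L * d2)%N; last by rewrite /w; lia.
  by rewrite expnD (expnM 2 (d2 * L) d1) (expnM 2 L d2) leq_mul ?leq_expn_base.
have hH : (((D * (b1 ^ d1 * b2 ^ d2)) ^ D).+1 <= 2 ^ (((D + w) * D + 1) * L))%N.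
  have h3 : ((D * (b1 ^ d1 * b2 ^ d2)) ^ D <= 2 ^ ((D + w) * D * L))%N.
    rewrite mulnAC expnM leq_expn_base // mulnDl expnD leq_mul //.
  apply: (@leq_trans (2 ^ ((D + w) * D * L)).+1) => //.
  apply: (@leq_trans (2 * 2 ^ ((D + w) * D * L))).
    by rewrite mul2n -addnn -addn1 leq_add2l expn_gt0.
  by rewrite -expnS leq_exp2l //; move: ((D + w) * D)%N => A; nia.
rewrite mulnDl expnD leq_mul //.
  by rewrite mulnDl mul1n expnD leq_mul.
rewrite mulnDl expnD leq_mul // mulnDl expnD leq_mul //.
by rewrite mulnDl expnD leq_mul.
Qed.

(* With [d = d2] and [e = d L]: [R] stands for b1^(2/d) rounded up, so [p > 2^8 R] gives
   p^(e-1) >> b1^(2L) up to the constant, which absorbs [b2 ^ d <= 2 ^ e]. *)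
Lemma prime_power_beats (p e d L R b1 b2 : nat) :
  e = (d * L)%N -> (1 < d)%N -> (0 < L)%N -> (0 < R)%N -> (2 ^ 8 * R < p)%N ->
  (b1 ^ 2 <= R ^ d)%N -> (b2 <= 2 ^ L)%N -> (R <= 2 ^ (2 * L))%N -> (0 < b1)%N -> (0 < b2)%N ->
  (2 * e * (p ^ e.+1 * (b1 ^ (2 * L).-1 * b2 ^ d.-1)) < p ^ (2 * e))%N.
Proof.
move=> Ee d1 L0 R0 hp h1 h2 hR b10 b20.
have e2 : (1 < e)%N by rewrite Ee; nia.
have p0 : (0 < p)%N by apply: leq_ltn_trans hp.
have -> : (p ^ (2 * e) = p ^ e.+1 * p ^ e.-1)%N by rewrite -expnD; congr (_ ^ _)%N; lia.
rewrite mulnCA ltn_pmul2l ?expn_gt0 ?p0 //.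
apply: (@leq_ltn_trans (2 * e * (b1 ^ (2 * L) * b2 ^ d))).
  by rewrite leq_mul // leq_mul // leq_pexp2l ?leq_pred.
(* Multiplying by [R] completes [R ^ e.-1] to [R ^ e], which dominates [b1 ^ (2 * L)]. *)
rewrite -(ltn_pmul2l R0).
apply: (@leq_trans (R * (2 ^ 8 * R) ^ e.-1)); last by rewrite leq_mul2l leq_expn_base ?orbT // ltnW.
have -> : (R * (2 ^ 8 * R) ^ e.-1 = 2 ^ (8 * e.-1) * R ^ e)%N.
  rewrite expnMn mulnCA [in RHS]expnM; congr (_ * _)%N.
  by rewrite -[LHS](expnS R) prednK // ltnW.
have hb : (b1 ^ (2 * L) <= R ^ e)%N by rewrite expnM Ee expnM leq_expn_base.
have h3 : (2 ^ (3 * e + 1) * b1 ^ (2 * L) < 2 ^ (8 * e.-1) * R ^ e)%N.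
  apply: (@leq_trans (2 ^ (8 * e.-1) * b1 ^ (2 * L))); last by rewrite leq_mul2l hb orbT.
  (* The inequality [3 * e + 1 < 8 * e.-1] holds from [e = 2] on; hence the factor [2 ^ 8]. *)
  by rewrite ltn_pmul2r ?expn_gt0 ?b10 // ltn_exp2l //; lia.
apply: leq_ltn_trans h3.
(* The three powers of 2 absorb [R], [2 * e] and [b2 ^ d] in turn. *)
have -> : (2 ^ (3 * e + 1) * b1 ^ (2 * L) = 2 ^ e * (2 ^ e.+1 * (b1 ^ (2 * L) * 2 ^ e)))%N.
  have -> : (2 ^ (3 * e + 1) = 2 ^ e * (2 ^ e.+1 * 2 ^ e))%N.
    by rewrite -!expnD; congr (_ ^ _)%N; lia.
  by rewrite -!mulnA; congr (_ * (_ * _))%N; exact: mulnC.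
apply: leq_mul; first by apply: leq_trans hR _; rewrite leq_exp2l // Ee leq_mul2r d1 orbT.
apply: leq_mul; first by rewrite expnS leq_mul2l /= ltnW // ltn_expl.
by rewrite leq_mul2l; apply/orP; right; rewrite Ee (mulnC d) expnM leq_expn_base.
Qed.

(** Supplies [exists_good_prime] with [X = 2 ^ (d3 * L)]. The loss [2 * u * P] in
    [exists_many_primes] is of order [R * L], whence the length of the window. *)
Lemma exists_window (d3 R L : nat) : (0 < R)%N -> (0 < L)%N -> (R <= 2 ^ (2 * L))%N ->
  exists S : seq nat, [/\ uniq S, all prime S,
    forall p, p \in S -> (2 ^ 8 * R < p <= 2 ^ (d3 + 22) * R * L)%N
    & (2 ^ (2 * (d3 * L)) < \prod_(p <- S) p)%N].
Proof.
(* The 10 lets [2 ^ c2] exceed the linear expression in [hc]; the final bound [4 * t ^ 2 <= 16 * n]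
   accounts for 22 = 10 + 8 + 4. *)
move=> R0 L0 hR; pose c2 := (d3 + 10)%N; pose P := (2 ^ 8 * R)%N.
pose n := (2 ^ c2 * P * L)%N.
have P0 : (0 < P)%N by rewrite muln_gt0 R0 expn_gt0.
have n10 : (2 ^ 10 <= n)%N.
  rewrite /n -mulnA; apply: leq_trans (leq_pmulr _ _); last by rewrite muln_gt0 P0.
  by rewrite leq_exp2l // leq_addl.
have [t nt t4] : exists2 t, (n < t ^ 2)%N & (t ^ 2 <= 4 * n)%N.
  have ex : exists t, (n < t ^ 2)%N by exists n.+1; nia.
  case: (ex_minnP ex) => t nt tmin; exists t => //.
  have t2 : (1 < t)%N by move: nt; case: (t) => [|[|?]] //; rewrite ?exp1n ?exp0n // => nt; move: n10 nt; lia.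
  have : (t.-1 ^ 2 <= n)%N by rewrite leqNgt; apply/negP => /tmin; lia.
  nia.
have t32 : (32 <= t)%N.
  rewrite leqNgt; apply/negP => t32; move: nt; apply/negP; rewrite -leqNgt.
  by apply: leq_trans n10; rewrite (_ : 2 ^ 10 = 32 ^ 2)%N // leq_exp2r // ltnW.
pose u := ((c2 + 15) * L)%N.
have hL : (L <= 2 ^ L)%N by apply: ltnW; exact: ltn_expl.
have nle : (n <= 2 ^ (c2 + 8 + 3 * L))%N.
  rewrite /n /P (_ : c2 + 8 + 3 * L = c2 + (8 + 2 * L) + L)%N; last by lia.
  rewrite (expnD 2 (c2 + _)) (expnD 2 c2) (expnD 2 8).
  by apply: leq_mul => //; apply: leq_mul => //; apply: leq_mul.
have hu : (2 * t <= 2 ^ u)%N.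
  rewrite -(@leq_exp2r _ _ 2) // -expnM expnMn.
  apply: (@leq_trans (2 ^ 2 * (2 ^ 2 * 2 ^ (c2 + 8 + 3 * L)))).
    by rewrite leq_mul2l /=; apply: leq_trans t4 _; rewrite leq_mul2l.
  by rewrite -!expnD leq_exp2l // /u; nia.
have hY : (2 * u * P + 2 * (d3 * L) < t ^ 2)%N.
  apply: leq_ltn_trans nt.
  have hc : (2 * (c2 + 15) + 2 * d3 <= 2 ^ c2)%N.
    rewrite /c2 expnD; have := ltn_expl d3 (ltnSn 1); rewrite (_ : 2 ^ 10 = 1024)%N //; lia.
  apply: (@leq_trans ((2 * (c2 + 15) + 2 * d3) * (P * L))).
    by rewrite /u; nia.
  by rewrite /n -mulnA leq_mul2r hc orbT.
have [S [uS pS hS hp]] := exists_many_primes t32 hu hY.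
exists S; split=> // p /hS /andP[-> h]; rewrite /=; apply: leq_trans h _.
apply: (@leq_trans (2 ^ 2 * (2 ^ 2 * n))); first by rewrite leq_mul2l.
rewrite (_ : d3 + 22 = 2 + (2 + (c2 + 8)))%N; last by rewrite /c2; lia.
by rewrite (expnD 2 2 (2 + _)) (expnD 2 2 (c2 + _)) (expnD 2 c2) /n /P -!mulnA.
Qed.

(** Points where the X2-derivative of [g] vanishes, or all points if [g] has lower degree than [f]
    in X2, are counted by [bezout_int]; this is the summand [Z]. For the others a prime good for
    half of them is chosen and [good_points_leq] applies. *)
Lemma main_bound (d1 m2 : nat) : (0 < m2)%N -> exists C : nat,
  forall (f : {poly {poly int}}) (b1 b2 R L : nat) (s : seq (rat * rat)),
  irreducible_elt (castP rat f) -> bideg d1 m2.+1 f -> size f = m2.+2 ->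
  (0 < b1)%N -> (0 < b2)%N -> (0 < R)%N -> (0 < L)%N ->
  (b1 ^ 2 <= R ^ m2.+1)%N -> (b2 <= 2 ^ L)%N -> (b1 <= 2 ^ (m2.+1 * L))%N -> (R <= 2 ^ (2 * L))%N ->
  uniq s -> (forall z, z \in s -> htle b1 b2 z /\ ev2 (castP rat f) z.1 z.2 = 0) ->
  (size s <= C * R * L ^ 2)%N.
Proof.
move=> m20; set d2 := m2.+1; pose D := (d1.+1 * d2.+1)%N; pose w := (d1 * d2 + d2)%N.
pose d3 := (d2 + 1 + (D + (d2 + ((D + w) * D + 1) + w)))%N.
pose Z := (2 * d2 * d1 * d2)%N.
exists (Z + 2 * (2 ^ (d3 + 22) * d2 * (2 * d2 * (d1 + 2) * d2)))%N.
move=> f b1 b2 R L s firr fb sf b10 b20 R0 L0 hR hL hb1 hRL us hs.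
have f0 : f != 0 by rewrite -size_poly_gt0 sf.
have [g [gb g0 gH gz]] := small_vanishing_poly b10 b20 f0 fb hs.
have RL : (0 < R * L ^ 2)%N by rewrite muln_gt0 R0 expn_gt0 L0.
have vf z : z \in s -> ev2 (castP rat f) z.1 z.2 = 0 by case/hs.
have vg z : z \in s -> ev2 (castP rat g) z.1 z.2 = 0.
  by move=> /gz /eqP; rewrite (homq_eq0 _ gb) => /eqP.
have ZC : (Z <= (Z + 2 * (2 ^ (d3 + 22) * d2 * (2 * d2 * (d1 + 2) * d2))) * R * L ^ 2)%N.
  by rewrite -mulnA; apply: leq_trans (leq_pmulr _ RL); exact: leq_addr.
have [sg|sg] := leqP (size g) d2.
  apply: leq_trans ZC; apply: (bezout_int firr fb sf g0 sg gb.2 us) => z zs.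
  by split; [exact: vf | exact: vg].
have Esg : size g = d2.+1 by apply/eqP; rewrite eqn_leq gb.1.
(* The leading coefficient of the derivative is [d2] times that of [g]. *)
have gd0 : g^`() != 0.
  apply: contraNneq g0 => /polyP/(_ m2); rewrite coef_deriv coef0 => E.
  rewrite -lead_coef_eq0 lead_coefE Esg; apply/eqP/polyP => i.
  by have /eqP := congr1 (fun q : {poly int} => q`_i) E; rewrite /= coefMn coef0 mulrn_eq0 => /eqP.
have sgd : (size g^`() <= d2)%N by have := lt_size_deriv g0; rewrite Esg ltnS.
have gdb := deriv_bideg gb.
pose a := fun z : rat * rat => ev2 (castP rat g^`()) z.1 z.2 == 0.
have hs1 : (size [seq z <- s | a z] <= Z)%N.
  apply: (bezout_int firr fb sf gd0 sgd gdb.2 (filter_uniq _ us)) => z.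
  by rewrite mem_filter => /andP[/eqP -> /vf].
(* A prime is good at [z] exactly when it does not divide [M z]. *)
pose M z := (`|denq z.1| * `|denq z.2| * `|homq d1 d2 g^`() z|)%N.
set s2 := [seq z <- s | ~~ a z].
have hM z : z \in s2 -> (0 < M z <= 2 ^ (d3 * L))%N.
  rewrite mem_filter => /andP[az zs]; rewrite !muln_gt0 !absz_gt0 !denq_neq0 /=.
  rewrite (homq_eq0 _ gdb) az /=; have [/and4P[h1 h2 h3 h4] _] := hs z zs.
  apply: leq_trans (bad_modulus_exponent d1 L0 hb1 hL).
  have absle (n : int) (k : nat) : `|n| <= k%:Z -> (`|n|%N <= k)%N by lia.
  rewrite leq_mul // ?leq_mul ?absle //.
  exact: (hom_norm _ _ (deriv_norm gb gH) h1 h2 h3 h4).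
have [S [uS pS hS hp]] := exists_window d3 R0 L0 hRL.
have X0 : (0 < 2 ^ (d3 * L))%N by rewrite expn_gt0.
have hX : ((2 ^ (d3 * L)) ^ 2 < \prod_(p <- S) p)%N by rewrite -expnM mulnC.
have [p pinS hcount] := exists_good_prime X0 hM uS pS hX.
have pr : prime p by move/allP: pS; apply.
have /andP[Pp pL] := hS _ pinS.
set s3 := [seq z <- s2 | ~~ (p %| M z)%N].
(* The auxiliary polynomial has [2 * L] by [d2], that is [2 * e], coefficients; [K.+1 = 2 * e] and
   [H = p ^ e.+1]. The congruences cost [p ^ (e * (2 * e).+1)], less than [H ^ (2 * e)] by [he]. *)
pose e := (d2 * L)%N.
have e0 : (0 < e)%N by rewrite muln_gt0 L0.
have L2 : ((2 * L).-1.+1 = 2 * L)%N by rewrite prednK // muln_gt0.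
have K2 : ((2 * e).-1.+1 = 2 * e)%N by rewrite prednK // muln_gt0.
have W : (2 * L * m2.+1 = 2 * e)%N by rewrite -mulnA (mulnC L).
have he : (e * (2 * e).+1 < e.+1 * (2 * e))%N by move: (e) e0 => x x0; nia.
have hs3 : (size s3 <= p * d2 * (2 * d2 * (d1 + 2 * L) * d2))%N.
  apply: (@good_points_leq f g p d1 d2 (2 * L).-1 m2 (d1 + 2 * L) (2 * e).-1 (p ^ e.+1) b1 b2) => //.
  - by split; [exact: fb.1 | move=> j; apply: leq_trans (fb.2 j) _; rewrite ltnS leq_addr].
  - by apply: leq_trans (leq_pred _) (leq_addl _ _).
  - by rewrite K2 L2 W prod_expn_desc -expnM ltn_exp2l ?prime_gt1.
  - rewrite K2 L2 W.
    exact: (prime_power_beats (erefl e) _ L0 R0 Pp hR hL hRL b10 b20).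
  - by rewrite !filter_uniq.
  - move=> z; rewrite mem_filter => /andP[hz]; rewrite mem_filter => /andP[_ zs].
    have [h1 h2] := hs z zs; split=> //; first exact: gz.
    by move: hz; rewrite /M !Euclid_dvdM // !negb_or !dvdzE !absz_nat -andbA.
have Es : (size s = size [seq z <- s | a z] + size s2)%N by rewrite /s2 !size_filter count_predC.
have {}hcount : (size s2 <= 2 * size s3)%N by rewrite /s3 size_filter.
have key c r l d x :
    (2 * (c * r * l * d * (2 * d * (x * l) * d)) = 2 * (c * d * (2 * d * x * d)) * r * l ^ 2)%N.
  by rewrite -mulnn; ring.
rewrite Es (mulnDl Z) (mulnDl (Z * R)); apply: leq_add.
  by rewrite -mulnA; apply: leq_trans hs1 (leq_pmulr _ RL).
rewrite -key; apply: leq_trans hcount _.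
rewrite leq_mul2l; apply/orP; right; apply: leq_trans hs3 _.
apply: leq_mul; first by rewrite leq_mul2r pL orbT.
apply: leq_mul (leqnn _); apply: leq_mul (leqnn _) _.
by rewrite mulnDl leq_add // leq_pmulr.
Qed.

(** * Remaining ranges and the passage to real bounds *)

Lemma eval2_ev2 f x y : eval2 f x y = ev2 (castP rat f) x y.
Proof.
rewrite ev2_spec /eval2; congr (_.[y]); apply/polyP => j.
by rewrite coef_map_id0 ?rmorph0 ?horner0 // coef_map /castP coef_map.
Qed.

Lemma degX_bideg d1 d2 f : degX1 f = d1 -> degX2 f = d2 -> (0 < d2)%N ->
  bideg d1 d2 f /\ size f = d2.+1.
Proof.
rewrite /degX1 /degX2 => h1 h2 d20.
have sf : size f = d2.+1 by rewrite -h2 prednK //; move: d20; rewrite -h2; case: (size f).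
split=> //; split; first by rewrite sf.
move=> j; have [jl|jl] := ltnP j (size f); last by rewrite nth_default ?size_poly0.
have : ((size (f`_j)%R).-1 <= d1)%N by rewrite -h1; exact: (leq_bigmax (Ordinal jl)).
by case: (size _).
Qed.

Lemma size_ht_seq_leq N : (0 < N)%N -> (size (ht_seq N) <= 3 * N ^ 2)%N.
Proof.
move=> N0; apply: leq_trans (size_undup _) _; rewrite size_allpairs size_map !size_iota.
by rewrite -mulnn; nia.
Qed.

Lemma size_undup_map_leq (T U : eqType) (h : T -> U) (s : seq T) (t : seq U) :
  (forall z, z \in s -> h z \in t) -> (size (undup (map h s)) <= size t)%N.
Proof.
move=> hs; apply: uniq_leq_size (undup_uniq _) _ => u.
by rewrite mem_undup => /mapP[z /hs ? ->].
Qed.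

(** In degree 1 in X2 a point is determined by its first coordinate, and [N ^ 2] already has the
    order of the bound sought. *)
Lemma vertical_fibers_leq f d1 N (s : seq (rat * rat)) :
  irreducible_elt (castP rat f) -> bideg d1 1 f -> size f = 2%N -> (0 < N)%N -> uniq s ->
  (forall z, z \in s -> ev2 (castP rat f) z.1 z.2 = 0 /\ z.1 \in ht_seq N) ->
  (size s <= 3 * N ^ 2)%N.
Proof.
move=> firr fb sf N0 us hs; apply: leq_trans (size_ht_seq_leq N0).
apply: leq_trans (size_fiber_leq (phi := fst) (B := 1) _) _ => [u|].
  rewrite -(size_map snd) -[X in (_ <= X)%N]/(2.-1) -sf -castP_size.
  apply: (@irreducible_fiber_leq _ u) firr _ (uniq_fst_fiber _ us) _.
    by rewrite castP_size sf.
  by move=> y /mapP[[a b]]; rewrite mem_filter => /andP[/= /eqP <- /hs[/= h _]] ->.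
by rewrite muln1; apply: size_undup_map_leq => z /hs[].
Qed.

(** Bezout with the line X2 = u, of degree 1 < [d2], bounds each fibre. This count is efficient when
    the second height bound is small compared with the first. *)
Lemma horizontal_fibers_leq f d1 d2 N (s : seq (rat * rat)) :
  irreducible_elt (castP rat f) -> bideg d1 d2 f -> size f = d2.+1 -> (1 < d2)%N ->
  (0 < N)%N -> uniq s ->
  (forall z, z \in s -> ev2 (castP rat f) z.1 z.2 = 0 /\ z.2 \in ht_seq N) ->
  (size s <= 3 * N ^ 2 * (2 * d2 * d1 * d2))%N.
Proof.
move=> firr fb sf d21 N0 us hs.
apply: leq_trans (size_fiber_leq (phi := snd) (B := 2 * d2 * d1 * d2) _) _ => [u|].
  pose g : {poly {poly rat}} := 'X - u%:P%:P.
  have [_ fc] := castP_bideg rat fb.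
  have := @bezout_bound (castP rat f) g d1 [seq z <- s | z.2 == u] firr.
  rewrite castP_size sf; apply.
  - by rewrite polyXsubC_eq0.
  - by rewrite size_XsubC ltnS.
  - by [].
  - move=> j; rewrite coefB coefX coefC; apply: leq_trans (size_polyD _ _) _.
    rewrite size_polyN geq_max; apply/andP; split.
      by case: eqP; rewrite ?size_poly1 ?size_poly0.
    by case: eqP; rewrite ?size_poly0 // size_polyC; case: eqP.
  - by rewrite filter_uniq.
  - move=> z; rewrite mem_filter => /andP[/eqP E /hs[h _]]; split=> //.
    by rewrite /g -E /ev2 hornerXsubC hornerD hornerN !hornerC subrr.
rewrite leq_mul2r; apply/orP; right; apply: leq_trans (size_ht_seq_leq N0).
by apply: size_undup_map_leq => z /hs[].
Qed.

(** The two conditions on [R] make it [b1 ^ (2 / d2)] rounded up. Three ranges are separated: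
    [d2 = 1]; [b1 <= b2 ^ d2], where [main_bound] applies; and [b1 > b2 ^ d2], where [b2 ^ 2 <= R]
    makes the horizontal count enough. *)
Lemma count_bound (d1 d2 : nat) : (0 < d2)%N -> exists C : nat,
  forall (f : {poly {poly int}}) (b1 b2 R L : nat) (s : seq (rat * rat)),
  irreducible_elt (castP rat f) -> bideg d1 d2 f -> size f = d2.+1 ->
  (0 < b1)%N -> (0 < b2)%N -> (0 < R)%N -> (0 < L)%N ->
  (b1 ^ 2 <= R ^ d2)%N -> (R.-1 ^ d2 < b1 ^ 2)%N -> (b2 <= 2 ^ L)%N -> uniq s ->
  (forall z, z \in s -> [/\ htle b1 b2 z, ev2 (castP rat f) z.1 z.2 = 0,
     z.1 \in ht_seq b1 & z.2 \in ht_seq b2]) ->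
  (size s <= C * R * L ^ 2)%N.
Proof.
case: d2 => // -[|m2] _.
  exists 3%N => f b1 b2 R L s firr fb sf b10 _ R0 L0 hR _ _ us hs.
  apply: (@leq_trans (3 * R)); last by rewrite leq_pmulr // expn_gt0 L0.
  apply: (@leq_trans (3 * b1 ^ 2)); last by rewrite leq_mul2l -[R]expn1 hR orbT.
  by apply: (vertical_fibers_leq firr fb) => // z /hs[].
set d2 := m2.+2; have [C hC] := @main_bound d1 m2.+1 isT.
exists (C + 3 * (2 * d2 * d1 * d2))%N => f b1 b2 R L s firr fb sf b10 b20 R0 L0 hR hR' hL us hs.
have [hb|hb] := leqP b1 (b2 ^ d2).
  apply: (@leq_trans (C * R * L ^ 2)); last by rewrite !leq_mul // leq_addr.
  have pb : (b2 ^ d2 <= 2 ^ (d2 * L))%N by rewrite mulnC expnM leq_exp2r.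
  apply: (hC f b1 b2) => //; first exact: leq_trans hb pb.
    (* Here [R.-1 ^ d2 < b1 ^ 2 <= b2 ^ (2 * d2)], hence [R <= b2 ^ 2 <= 2 ^ (2 * L)]. *)
    rewrite -(prednK R0); apply: (@leq_trans (b2 ^ 2)); last by rewrite mulnC expnM leq_exp2r.
    rewrite -(@ltn_exp2r _ _ d2) //; apply: leq_trans hR' _.
    by rewrite -expnM mulnC expnM leq_exp2r.
  by move=> z /hs[].
have b2R : (b2 ^ 2 <= R)%N.
  rewrite -(@leq_exp2r _ _ d2) //; apply: leq_trans hR.
  by rewrite -expnM mulnC expnM leq_exp2r // ltnW.
apply: (@leq_trans (3 * b2 ^ 2 * (2 * d2 * d1 * d2))).
  by apply: (horizontal_fibers_leq firr fb) => // z /hs[].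
apply: (@leq_trans ((C + 3 * (2 * d2 * d1 * d2)) * R)); last by rewrite leq_pmulr // expn_gt0 L0.
rewrite mulnAC; apply: leq_mul b2R; exact: leq_addl.
Qed.

Lemma root_bound (R : realType) (d r b : nat) (B : R) : (0 < d)%N -> 0 <= B ->
  (r ^ d < b ^ 2)%N -> b%:R <= B -> r%:R <= B `^ (2 / d%:R).
Proof.
move=> d0 B0 hr hb; have dn0 : d%:R != 0 :> R by rewrite pnatr_eq0 -lt0n.
have -> : r%:R = (r%:R ^+ d) `^ (d%:R)^-1 :> R.
  by rewrite -powR_mulrn // -powRrM mulfV // powRr1.
have -> : B `^ (2 / d%:R) = (B ^+ 2) `^ (d%:R)^-1.
  by rewrite -powR_mulrn // -powRrM.
apply: ge0_ler_powR; rewrite ?nnegrE ?exprn_ge0 ?invr_ge0 //.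
apply: (@le_trans _ _ (b%:R ^+ 2)); first by rewrite -!natrX ler_nat ltnW.
by rewrite lerXn2r ?nnegrE.
Qed.

(** Rounding the binary logarithm up adds at most 1, which is at most [ln B / ln 2] since
    [B >= 2]. *)
Lemma up_log_leq_ln (R : realType) (b : nat) (B : R) : (1 < b)%N -> b%:R <= B ->
  (up_log 2 b)%:R <= 2 / ln 2 * ln B.
Proof.
move=> b1 hb; have l2 : 0 < ln 2 :> R by rewrite ln_gt0 ?ltr1n.
have B2 : 2 <= B by apply: le_trans hb; rewrite ler_nat.
have B0 : 0 < B by apply: lt_le_trans B2.
have h1 : ln 2 <= ln B by rewrite ler_ln ?posrE.
have h2 : (up_log 2 b).-1%:R * ln 2 <= ln B.
  rewrite mulr_natl -lnXn // ler_ln ?posrE ?exprn_gt0 //.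
  by apply: le_trans hb; rewrite -natrX ler_nat ltnW // up_log_gtn.
rewrite mulrAC ler_pdivlMr //.
have : (0 < up_log 2 b)%N by rewrite up_log_gt0.
by case: (up_log 2 b) h2 => //= k h2 _; rewrite -natr1 mulrDl mul1r; lra.
Qed.

Theorem theorem1p4 (R : realType) (d1 d2 : nat) :
  exists C : R, 0 < C /\
    forall f : {poly {poly int}},
      irreducible_over_Q f -> degX1 f = d1 -> degX2 f = d2 -> (1 <= d2)%N ->
      forall B1 B2 : R, 1 <= B1 -> 2 <= B2 ->
        ((N_rat f B1 B2)%:R : R) <= C * B1 `^ (2 / d2%:R) * (ln B2) ^+ 2.
Proof.
(* For [d2 = 0] the claim is vacuous, because of the requirement [1 <= d2] on [f]. *)
have [->|d20] := posnP d2; first by exists 1; split.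
have [C hC] := count_bound d1 d20.
have l2 : 0 < ln 2 :> R by rewrite ln_gt0 ?ltr1n.
(* The 2 pays for the rounding in [r], [2 / ln 2] for the rounding in [L], and [C.+1] keeps the
   constant positive. *)
exists (C.+1%:R * 2 * (2 / ln 2) ^+ 2); split.
  by rewrite mulr_gt0 ?exprn_gt0 ?divr_gt0 // mulr_gt0 ?ltr0n.
move=> f firr hd1 hd2 _ B1 B2 hB1 hB2.
have [fb sf] := degX_bideg hd1 hd2 d20.
set b1 := Num.truncn B1; set b2 := Num.truncn B2.
have B10 : 0 <= B1 by apply: le_trans hB1.
have B20 : 0 <= B2 by apply: le_trans hB2.
have b10 : (0 < b1)%N by rewrite truncn_gt_nat.
have b21 : (1 < b2)%N by rewrite truncn_gt_nat.
have hb1 : b1%:R <= B1 by rewrite truncn_le.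
have hb2 : b2%:R <= B2 by rewrite truncn_le.
have exr : exists r, (b1 ^ 2 <= r ^ d2)%N.
  by exists (b1 ^ 2)%N; rewrite -{1}[(b1 ^ 2)%N]expn1 leq_pexp2l // expn_gt0 b10.
(* [r] is [b1 ^ (2 / d2)] rounded up. *)
case: (ex_minnP exr) => r hr rmin.
have r0 : (0 < r)%N.
  by rewrite lt0n; apply: contraTneq hr => ->; rewrite exp0n // -ltnNge expn_gt0 b10.
have hr' : (r.-1 ^ d2 < b1 ^ 2)%N.
  by rewrite ltnNge; apply/negP => /rmin; case: (r) r0 => //= k _; rewrite ltnn.
set L := up_log 2 b2.
have L0 : (0 < L)%N by rewrite up_log_gt0.
have hN : (N_rat f B1 B2 <= C * r * L ^ 2)%N.
  apply: (hC f b1 b2) => //; first exact: ltnW.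
  - exact: up_logP.
  - apply: filter_uniq; apply: allpairs_uniq; rewrite ?undup_uniq //.
    by move=> [a b] [a' b'] _ _ /= [-> ->].
  - move=> z; rewrite mem_filter => /andP[/and3P[/eqP h1 h2 h3] hz].
    split; last 2 first.
    + by case/allpairsP: hz => -[a b] /= [ha hb ->].
    + by case/allpairsP: hz => -[a b] /= [ha hb ->].
    + move: h2 h3; rewrite -!truncn_ge_nat // /ht !geq_max -/b1 -/b2.
      by move=> /andP[? ?] /andP[? ?]; apply/and4P; split; lia.
    + by rewrite -eval2_ev2.
apply: (@le_trans _ _ (C * r * L ^ 2)%:R); first by rewrite ler_nat.
(* [r.-1] is at most the power of [B1], and that power is at least 1. *)
have hrB : r%:R <= 2 * B1 `^ (2 / d2%:R).
  have h1 := root_bound d20 B10 hr' hb1.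
  have h2 : 1 <= B1 `^ (2 / d2%:R).
    by rewrite -[X in X <= _](powRr0 B1) ler_powR // divr_ge0.
  by rewrite -(prednK r0) -natr1; lra.
have hLB := up_log_leq_ln b21 hb2.
have -> : C.+1%:R * 2 * (2 / ln 2) ^+ 2 * B1 `^ (2 / d2%:R) * ln B2 ^+ 2 =
  C.+1%:R * (2 * B1 `^ (2 / d2%:R)) * (2 / ln 2 * ln B2) ^+ 2 by ring.
rewrite natrM natrX natrM; apply: ler_pM => //.
- by apply: ler_pM => //; rewrite ler_nat.
- by rewrite lerXn2r ?nnegrE // (le_trans _ hLB).
Qed.
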